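(* For every ordinary reduced polygon $V\subset\mathbb{H}^2$, $$\mathrm{diam}(V) < \operatorname{arccosh}\left(\cosh\Delta(V)\cdot\sqrt{1+\tfrac13\sinh^2\Delta(V)}\right).$$
   Context: A convex $k$-gon $V=v_1\dots v_k$ in $\mathbb{H}^2$ is the convex hull of $k\ge3$ points none in the convex hull of the others, listed in positive boundary order. For a line $H$ supporting a convex body $C$ (compact convex set with nonempty interior), $\mathrm{width}_H(C)$ is the distance between $H$ and a farthest line ultraparallel to $H$ supporting $C$; the thickness $\Delta(C)$ is the minimum of $\mathrm{width}_H(C)$ over supporting lines $H$. An ordinary reduced polygon is a convex $n$-gon $V=v_1\dots v_n$ with $n$ odd such that for every $i$ (indices modulo $n$), the orthogonal projection of $v_i$ onto the line $L_i$ containing the side $v_{i+(n-1)/2}v_{i+(n+1)/2}$ lies in the relative interior of that side, and the distance from $v_i$ to $L_i$ equals $\Delta(V)$. $\mathrm{diam}(V)$ is the maximal hyperbolic distance between two points of $V$. *)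

(* Defs.v *)
(* Model of H^2: the Beltrami-Klein model in the open unit disk
   of R^2.  Geodesics are (intersections of the disk with) Euclidean lines,
   hyperbolic convex hulls are Euclidean convex hulls, and
   cosh d(p,q) = (1 - p.q) / sqrt((1-|p|^2)(1-|q|^2)). *)
From Stdlib Require Import Reals Lra Arith.
Open Scope R_scope.

Definition pt := (R * R)%type.

Definition in_disk (p : pt) : Prop := fst p * fst p + snd p * snd p < 1.

Definition arcosh (z : R) : R := ln (z + sqrt (z * z - 1)).

Definition hdist (p q : pt) : R :=
  arcosh ((1 - (fst p * fst q + snd p * snd q)) /
          sqrt ((1 - (fst p * fst p + snd p * snd p)) *
                (1 - (fst q * fst q + snd q * snd q)))).

Fixpoint sumR (n : nat) (f : nat -> R) : R :=
  match n with O => 0 | S k => sumR k f + f k end.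

Definition line := (R * R * R)%type.
Definition on_line (l : line) (p : pt) : Prop :=
  let '(a, b, c) := l in a * fst p + b * snd p = c.
Definition is_line (l : line) : Prop :=
  let '(a, b, c) := l in (a <> 0 \/ b <> 0) /\ exists p, in_disk p /\ on_line l p.

Definition line_through (p q : pt) : line :=
  (snd p - snd q, fst q - fst p, (snd p - snd q) * fst p + (fst q - fst p) * snd p).

(* two lines are ultraparallel: their closures in the closed disk
   (i.e. including ideal points) are disjoint *)
Definition ultraparallel (l1 l2 : line) : Prop :=
  ~ exists p : pt, fst p * fst p + snd p * snd p <= 1 /\ on_line l1 p /\ on_line l2 p.

Definition supporting (C : pt -> Prop) (l : line) : Prop :=
  is_line l /\ (exists p, C p /\ on_line l p) /\
  (let '(a, b, c) := l in forall p, C p -> a * fst p + b * snd p <= c).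

Definition is_glb (S : R -> Prop) (m : R) : Prop :=
  (forall s, S s -> m <= s) /\ (forall m', (forall s, S s -> m' <= s) -> m' <= m).

Definition line_dist (l1 l2 : line) (d : R) : Prop :=
  is_glb (fun s => exists p q, in_disk p /\ on_line l1 p /\ in_disk q /\ on_line l2 q
                               /\ s = hdist p q) d.

Definition is_width (C : pt -> Prop) (H : line) (w : R) : Prop :=
  exists L, supporting C L /\ ultraparallel H L /\ line_dist H L w /\
    forall L' d', supporting C L' -> ultraparallel H L' -> line_dist H L' d' -> d' <= w.

Definition is_thickness (C : pt -> Prop) (t : R) : Prop :=
  (exists H, supporting C H /\ is_width C H t) /\
  (forall H w, supporting C H -> is_width C H w -> t <= w).

Definition is_diam (C : pt -> Prop) (D : R) : Prop :=
  (exists p q, C p /\ C q /\ hdist p q = D) /\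
  (forall p q, C p -> C q -> hdist p q <= D).

Definition hull (n : nat) (v : nat -> pt) (p : pt) : Prop :=
  exists w : nat -> R, (forall i, (i < n)%nat -> 0 <= w i) /\ sumR n w = 1 /\
    fst p = sumR n (fun i => w i * fst (v i)) /\ snd p = sumR n (fun i => w i * snd (v i)).

Definition in_hull_others (n : nat) (v : nat -> pt) (j : nat) : Prop :=
  exists w : nat -> R, (forall i, (i < n)%nat -> 0 <= w i) /\ w j = 0 /\ sumR n w = 1 /\
    fst (v j) = sumR n (fun i => w i * fst (v i)) /\
    snd (v j) = sumR n (fun i => w i * snd (v i)).

Definition orient (p q r : pt) : R :=
  (fst q - fst p) * (snd r - snd p) - (snd q - snd p) * (fst r - fst p).

(* v 0 ... v (n-1) is a convex n-gon listed in positive (counterclockwise)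
   boundary order *)
Definition convex_polygon (n : nat) (v : nat -> pt) : Prop :=
  (3 <= n)%nat /\
  (forall i, (i < n)%nat -> in_disk (v i)) /\
  (forall j, (j < n)%nat -> ~ in_hull_others n v j) /\
  (forall i j, (i < n)%nat -> (j < n)%nat -> j <> i -> j <> ((i + 1) mod n)%nat ->
     0 < orient (v i) (v ((i + 1) mod n)) (v j)).

(* f is the orthogonal projection (foot of the perpendicular, i.e. the
   nearest point) of p onto the line l *)
Definition is_foot (p : pt) (l : line) (f : pt) : Prop :=
  in_disk f /\ on_line l f /\
  forall q, in_disk q -> on_line l q -> hdist p f <= hdist p q.

Definition ordinary_reduced (n : nat) (v : nat -> pt) : Prop :=
  Nat.Odd n /\ convex_polygon n v /\
  exists Delta, is_thickness (hull n v) Delta /\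
  forall i, (i < n)%nat ->
    let a := v ((i + (n - 1) / 2) mod n)%nat in
    let b := v ((i + (n + 1) / 2) mod n)%nat in
    exists f, is_foot (v i) (line_through a b) f /\
      (exists t, 0 < t < 1 /\ fst f = fst a + t * (fst b - fst a) /\
                              snd f = snd a + t * (snd b - snd a)) /\
      hdist (v i) f = Delta.

(* Main.v *)
(* Lift the polygon to the hyperboloid in Minkowski space. List the vertices as
   W_0, W_1, ... by jumping (n+1)/2 places, so that each of W_k and W_{k+1} is an
   end of the side opposite to the other; let F_k be the foot of the altitude from
   W_k, U_k = W_k + F_k (a fixed multiple of the midpoint of the
   altitude) and G_k the normal of the altitude, oriented so as to rotate
   monotonically, by pi in n steps. Since all altitudes have the same length, the
   reflection swapping W_k and W_{k+1} swaps the two altitudes; hence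
   G_k - G_{k+1} and U_k - U_{k+1} are multiples of W_k - W_{k+1}, and
   U_k - U_{k+1} = +-(c+1) tanh(x_k/2) (G_k - G_{k+1}), with c the hyperbolic cosine
   of the thickness and x_k the distance from W_k to F_{k+1}.

   For vertices W_0, W_p with p odd, rotating the altitudes about their successive
   intersections produces one perpendicular to the line W_0 W_p. With f its normal
   and g = <G_p - G_0, f>, summing the relation above along the rotation gives
   <U_p - U_0, f> <= (c+1) max_k tanh(x_k/2) min(g, 2-g). For the longest chord
   W_k W_{k+1} this yields d >= 2x, so the x_k are at most half the side a of the
   regular triangle with the same thickness; then for a diameter it yields
   diam <= a. Finally a is smaller than the bound of the theorem, because
   c = 2C - 1/C for C = cosh(a/2). *)
Require Import Defs.
From Stdlib Require Import Reals Lra Psatz Lia Arith.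
Open Scope R_scope.

(** * Minkowski space with a form of signature (2, 1) *)

Record vec := Vec { vx : R; vy : R; vt : R }.

Definition lor (u v : vec) : R := vx u * vx v + vy u * vy v - vt u * vt v.

(* Chosen so that [lor (cross u v) w] is the determinant of [u], [v], [w]. *)
Definition cross (u v : vec) : vec :=
  Vec (vy u * vt v - vt u * vy v) (vt u * vx v - vx u * vt v)
      (vy u * vx v - vx u * vy v).

Definition comb (a : R) (u : vec) (b : R) (v : vec) : vec :=
  Vec (a * vx u + b * vx v) (a * vy u + b * vy v) (a * vt u + b * vt v).

Definition det (u v w : vec) : R := lor (cross u v) w.

Lemma lor_sym u v : lor u v = lor v u.
Proof. unfold lor; ring. Qed.

Lemma lor_comb_l a u b v w : lor (comb a u b v) w = a * lor u w + b * lor v w.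
Proof. unfold lor, comb; simpl; ring. Qed.

Lemma lor_comb_r a u b v w : lor w (comb a u b v) = a * lor w u + b * lor w v.
Proof. unfold lor, comb; simpl; ring. Qed.

Lemma lor_cross_cross u v x y :
  lor (cross u v) (cross x y) = lor u y * lor v x - lor u x * lor v y.
Proof. unfold lor, cross; simpl; ring. Qed.

Lemma det_rot u v w : det u v w = det v w u.
Proof. unfold det, lor, cross; simpl; ring. Qed.

Lemma det_swap u v w : det u v w = - det v u w.
Proof. unfold det, lor, cross; simpl; ring. Qed.

Lemma det_id_1 u v : det u v u = 0.
Proof. unfold det, lor, cross; simpl; ring. Qed.

Lemma det_id_2 u v : det u v v = 0.
Proof. unfold det, lor, cross; simpl; ring. Qed.

(** Minus the Gram determinant; the sign comes from the one negative direction of the form. *)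
Lemma det_sqr u v w :
  det u v w * det u v w =
  - (lor u u * lor v v * lor w w + 2 * (lor u v * lor v w * lor u w)
     - lor u u * (lor v w * lor v w) - lor v v * (lor u w * lor u w)
     - lor w w * (lor u v * lor u v)).
Proof. unfold det, lor, cross; simpl; ring. Qed.

(** Cramer's rule expands [f] in the basis [x], [y], [z], so a linear form may be tested on these
    vectors. *)
Lemma lor_eq0 x y z v f :
  det x y z <> 0 -> lor v x = 0 -> lor v y = 0 -> lor v z = 0 -> lor v f = 0.
Proof.
  intros Hd Hx Hy Hz.
  assert (E : lor v f * det x y z =
    lor v x * lor (cross y z) f + lor v y * lor (cross z x) f
    + lor v z * lor (cross x y) f)
    by (unfold det, lor, cross; simpl; ring).
  rewrite Hx, Hy, Hz in E.
  apply (Rmult_eq_reg_r (det x y z)); [lra | exact Hd].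
Qed.

Lemma sqr_pos_inj a b : 0 < a -> 0 < b -> a * a = b * b -> a = b.
Proof. intros; nra. Qed.

(** * Two altitudes swapped by a reflection *)

(* Normal of the line through [f] and [w]; it is a unit vector when [s] is the
   hyperbolic sine of their distance. *)
Definition normal_of (s : R) (f w : vec) : vec :=
  comb (/ s) (cross f w) 0 (cross f w).

Lemma lor_normal_of s f w u : lor (normal_of s f w) u = det f w u / s.
Proof. unfold normal_of; rewrite lor_comb_l; unfold det, Rdiv; ring. Qed.

Lemma normal_of_unit s f w :
  0 < s -> lor w w = -1 -> lor f f = -1 -> lor w f * lor w f = 1 + s * s ->
  lor (normal_of s f w) (normal_of s f w) = 1.
Proof.
  intros Hs Hw Hf Hc.
  unfold normal_of; rewrite lor_comb_l, !lor_comb_r, lor_cross_cross.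
  rewrite (lor_sym f w), Hw, Hf, Hc. field; lra.
Qed.

(* [wi fi] and [wj fj] are altitudes whose feet lie on sides ending at [wj] and
   [wi]; the reflection swapping [wi] and [wj] swaps the altitudes. *)
Lemma chord_symmetry c s C S wi wj fi fj :
  0 < s -> c * c = 1 + s * s -> 1 < c ->
  lor wi wi = -1 -> lor wj wj = -1 -> lor fi fi = -1 -> lor fj fj = -1 ->
  lor wi fi = - c -> lor wj fj = - c ->
  lor wi wj = - (c * C) -> lor fi wj = - C -> lor fj wi = - C ->
  0 < C -> 0 < S -> S * S = C * C - 1 ->
  det wi wj fi < 0 -> det wi wj fj < 0 ->
  (forall f, lor (normal_of s fi wi) f + lor (normal_of s fj wj) f =
             S / (c * C - 1) * (lor wi f - lor wj f)) /\
  (forall f, (lor wi f + lor fi f) - (lor wj f + lor fj f) =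
             (c + 1) * ((C - 1) / S) *
             (lor (normal_of s fi wi) f + lor (normal_of s fj wj) f)) /\
  lor (normal_of s fi wi) wj = - S.
Proof.
  intros Hs Hc Hc1 Hwi Hwj Hfi Hfj Hi Hj Hij Hfw Hfw' HC HS HSC Di Dj.
  assert (HC1 : 1 < C) by nra.
  assert (HD : 1 < c * C) by nra.
  pose proof (det_sqr wi wj fi) as Ei. pose proof (det_sqr wi wj fj) as Ej.
  rewrite (lor_sym wj fi), Hwi, Hwj, Hfi, Hi, Hij, Hfw in Ei.
  rewrite (lor_sym wi fj), Hwi, Hwj, Hfj, Hj, Hij, Hfw' in Ej.
  assert (Pi : - det wi wj fi = s * S).
  { apply sqr_pos_inj; [lra | nra |].
    transitivity (s * s * (S * S)); [| ring].
    rewrite HSC. replace (s * s) with (c * c - 1) by lra. lra. }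
  assert (Pj : - det wi wj fj = s * S).
  { apply sqr_pos_inj; [lra | nra |].
    transitivity (s * s * (S * S)); [| ring].
    rewrite HSC. replace (s * s) with (c * c - 1) by lra. lra. }
  (* Normal of the chord; it completes [wi], [wj] to a basis, on which both identities are
     tested. *)
  set (z := cross wi wj).
  assert (Hz : det wi wj z <> 0).
  { unfold det, z. rewrite lor_cross_cross, (lor_sym wj wi), Hwi, Hwj, Hij. nra. }
  assert (Zi : lor z wi = 0) by apply det_id_1.
  assert (Zj : lor z wj = 0) by apply det_id_2.
  assert (Q1 : lor (normal_of s fi wi) wi = 0)
    by (rewrite lor_normal_of, det_id_2; unfold Rdiv; ring).
  assert (Q2 : lor (normal_of s fj wj) wj = 0)
    by (rewrite lor_normal_of, det_id_2; unfold Rdiv; ring).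
  assert (Q3 : lor (normal_of s fi wi) wj = - S).
  { rewrite lor_normal_of, det_rot.
    replace (det wi wj fi) with (- (s * S)) by lra. field; lra. }
  assert (Q4 : lor (normal_of s fj wj) wi = S).
  { rewrite lor_normal_of, det_rot, det_swap.
    replace (det wi wj fj) with (- (s * S)) by lra. field; lra. }
  assert (Q5 : lor (normal_of s fi wi) z + lor (normal_of s fj wj) z = 0).
  { rewrite !lor_normal_of. unfold det, z. rewrite !lor_cross_cross.
    rewrite (lor_sym wj wi), Hfw', Hfw, Hwi, Hwj, Hij, (lor_sym fi wi), Hi,
      (lor_sym fj wj), Hj. field; lra. }
  assert (Q6 : lor fi z = lor fj z).
  { rewrite (lor_sym fi z), (lor_sym fj z).
    change (det wi wj fi = det wi wj fj); lra. }
  assert (R1 : forall f, lor (normal_of s fi wi) f + lor (normal_of s fj wj) f =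
             S / (c * C - 1) * (lor wi f - lor wj f)).
  { intro f.
    set (g := comb 1 (comb 1 (normal_of s fi wi) 1 (normal_of s fj wj))
                   (- (S / (c * C - 1))) (comb 1 wi (-1) wj)).
    assert (G : forall u, lor g u =
      lor (normal_of s fi wi) u + lor (normal_of s fj wj) u
      - S / (c * C - 1) * (lor wi u - lor wj u))
      by (intro u; unfold g; rewrite !lor_comb_l; ring).
    assert (Z : lor g f = 0).
    { apply (lor_eq0 wi wj z); [exact Hz | | |]; rewrite G.
      - rewrite Q1, Q4, (lor_sym wj wi), Hwi, Hij. field; lra.
      - rewrite Q2, Q3, Hwj, Hij. field; lra.
      - rewrite Q5, (lor_sym wi z), (lor_sym wj z), Zi, Zj. ring. }
    rewrite G in Z. lra. }
  split; [exact R1 | split; [| exact Q3]].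
  intro f. rewrite R1.
  set (k := (c + 1) * (C - 1) / (c * C - 1)).
  replace ((c + 1) * ((C - 1) / S) * (S / (c * C - 1) * (lor wi f - lor wj f)))
    with (k * (lor wi f - lor wj f)) by (unfold k; field; lra).
  set (g := comb 1 (comb 1 (comb 1 wi 1 fi) (-1) (comb 1 wj 1 fj))
                 (- k) (comb 1 wi (-1) wj)).
  assert (G : forall u, lor g u = (lor wi u + lor fi u) - (lor wj u + lor fj u)
                                  - k * (lor wi u - lor wj u))
    by (intro u; unfold g; rewrite !lor_comb_l; ring).
  assert (Z : lor g f = 0).
  { apply (lor_eq0 wi wj z); [exact Hz | | |]; rewrite G.
    - rewrite (lor_sym wj wi), Hwi, Hij, Hfw', (lor_sym fi wi), Hi.
      unfold k; field; lra.
    - rewrite Hwj, Hij, Hfw, (lor_sym fj wj), Hj. unfold k; field; lra.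
    - rewrite Q6, (lor_sym wi z), (lor_sym wj z), Zi, Zj. ring. }
  rewrite G in Z. lra.
Qed.

(* The last hypothesis says that the line [wj fj] separates [fi] from [wi], so
   that the two altitudes cross. *)
Lemma altitudes_cross c s C S wi wj fi fj :
  0 < s -> c * c = 1 + s * s -> 1 < c ->
  lor wi wi = -1 -> lor wj wj = -1 -> lor fi fi = -1 -> lor fj fj = -1 ->
  lor wi fi = - c -> lor wj fj = - c ->
  lor wi wj = - (c * C) -> lor fi wj = - C -> lor fj wi = - C ->
  0 < C -> 0 < S -> S * S = C * C - 1 ->
  det wi wj fi < 0 -> det wi wj fj < 0 -> lor (normal_of s fj wj) fi < 0 ->
  -1 <= lor (normal_of s fi wi) (normal_of s fj wj) <= 1.
Proof.
  intros Hs Hc Hc1 Hwi Hwj Hfi Hfj Hi Hj Hij Hfw Hfw' HC HS HSC Di Dj Hx.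
  destruct (chord_symmetry c s C S wi wj fi fj) as (R1 & _ & Q3); auto.
  assert (HC1 : 1 < C) by nra.
  assert (HD : 1 < c * C) by nra.
  assert (P : 0 < S / (c * C - 1)) by (apply Rdiv_lt_0_compat; lra).
  (* At [fi], where the normal of the first altitude vanishes, the first identity turns the
     separation into this inequality. *)
  assert (Hcc : C < c).
  { specialize (R1 fi).
    rewrite (lor_normal_of s fi wi fi), det_id_1 in R1.
    rewrite Hi, (lor_sym wj fi), Hfw in R1. nra. }
  pose proof (R1 (normal_of s fi wi)) as E.
  rewrite (normal_of_unit s fi wi), (lor_sym wi), (lor_sym wj) in E; try lra.
  2:{ rewrite Hi; lra. }
  rewrite (lor_normal_of s fi wi wi), det_id_2, Q3, (lor_sym (normal_of s fj wj)) in E.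
  assert (E2 : S / (c * C - 1) * (0 / s - - S) = (C * C - 1) / (c * C - 1)).
  { rewrite <- HSC. field; lra. }
  rewrite E2 in E.
  assert (0 < (C * C - 1) / (c * C - 1)) by (apply Rdiv_lt_0_compat; nra).
  assert ((C * C - 1) / (c * C - 1) <= 2).
  { apply Rmult_le_reg_r with (c * C - 1); [lra|].
    unfold Rdiv; rewrite Rmult_assoc, Rinv_l; nra. }
  lra.
Qed.

(** * Altitudes rotating about their successive intersections *)

(* [G k] is the normal of the altitude through [W k], turned so that consecutive
   altitudes rotate monotonically; after a full period it has turned by pi. *)
Record star_system (n : nat) (c s t : R) (W F G : nat -> vec) (T nu : nat -> R)
  : Prop := {
  star_W : forall k, W (k + n)%nat = W k;
  star_F : forall k, F (k + n)%nat = F k;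
  star_odd : (-1) ^ n = -1;
  star_c : 1 < c;
  star_s : 0 < s;
  star_cs : c * c = 1 + s * s;
  star_WW : forall k, lor (W k) (W k) = -1;
  star_FF : forall k, lor (F k) (F k) = -1;
  star_WF : forall k, lor (W k) (F k) = - c;
  star_pos : forall k l, lor (W k) (W l) < 0;
  star_G : forall k f, lor (G k) f = (-1) ^ k * det (F k) (W k) f / s;
  star_turn : forall k f, lor (G k) f - lor (G (S k)) f =
     (-1) ^ k * nu k * (lor (W k) f - lor (W (S k)) f);
  star_shift : forall k f,
     (lor (W k) f + lor (F k) f) - (lor (W (S k)) f + lor (F (S k)) f) =
     (c + 1) * T k * (-1) ^ k * (lor (G k) f - lor (G (S k)) f);
  star_sign : forall m k, (m < k < m + n)%nat -> 0 < (-1) ^ k * lor (G m) (W k);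
  star_cross : forall k, -1 <= lor (G k) (G (S k)) <= 1;
  star_nu : forall k, 0 < nu k;
  star_T : forall k, 0 <= T k <= t
}.

Lemma pow_m1_sqr k : (-1) ^ k * (-1) ^ k = 1.
Proof. rewrite <- Rpow_mult_distr. replace (-1 * -1) with 1 by ring. apply pow1. Qed.

Lemma sign_change (h : nat -> R) p d :
  h p <= 0 -> 0 < h (p + d)%nat ->
  exists m, (p <= m < p + d)%nat /\ h m <= 0 /\ 0 < h (S m).
Proof.
  revert p; induction d as [| d IH]; intros p Hp Hd.
  - rewrite Nat.add_0_r in Hd; lra.
  - destruct (Rle_dec (h (S p)) 0) as [H | H].
    + destruct (IH (S p)) as (m & Hm & A); [exact H | | ].
      * replace (S p + d)%nat with (p + S d)%nat by lia; exact Hd.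
      * exists m; split; [lia | exact A].
    + exists p; split; [lia | split; [exact Hp | lra]].
Qed.

(** The triangle inequality summed along the steps; [f] will measure the rotation of the altitudes
    and [q] the motion of their midpoints. *)
Lemma dominated_variation (q f : nat -> R) t p d :
  (forall k, (p <= k < p + d)%nat ->
     f k <= f (S k) /\ Rabs (q k - q (S k)) <= t * (f (S k) - f k)) ->
  f p <= f (p + d)%nat /\ Rabs (q p - q (p + d)%nat) <= t * (f (p + d)%nat - f p).
Proof.
  induction d as [| d IH]; intro H.
  - rewrite Nat.add_0_r. split; [lra |].
    unfold Rminus; rewrite !Rplus_opp_r, Rabs_R0. lra.
  - destruct IH as [A B]; [intros k Hk; apply H; lia |].
    destruct (H (p + d)%nat) as [A' B']; [lia |].
    rewrite Nat.add_succ_r. split; [lra |].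
    replace (q p - q (S (p + d))) with
      ((q p - q (p + d)%nat) + (q (p + d)%nat - q (S (p + d)))) by ring.
    eapply Rle_trans; [apply Rabs_triang | lra].
Qed.

Lemma star_G_unit n c s t W F G T nu :
  star_system n c s t W F G T nu -> forall k, lor (G k) (G k) = 1.
Proof.
  intros H k.
  pose proof (star_s _ _ _ _ _ _ _ _ _ H) as Hs.
  rewrite (star_G _ _ _ _ _ _ _ _ _ H).
  unfold det. rewrite lor_sym, (star_G _ _ _ _ _ _ _ _ _ H).
  unfold det. rewrite lor_cross_cross, (lor_sym (F k) (W k)),
    (star_WW _ _ _ _ _ _ _ _ _ H), (star_FF _ _ _ _ _ _ _ _ _ H),
    (star_WF _ _ _ _ _ _ _ _ _ H).
  transitivity ((-1) ^ k * (-1) ^ k * (c * c - 1) / (s * s)); [field; lra |].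
  rewrite pow_m1_sqr, (star_cs _ _ _ _ _ _ _ _ _ H). field; lra.
Qed.

(* [f] is the normal of the altitude of the rotating family that is perpendicular
   to the line [W 0], [W p]; [x] and [y] are the hyperbolic sines of the distances
   of [W 0] and [W p] to it. The two bounds on the displacement of the altitudes'
   midpoints come from the two ways of rotating the altitude of [W 0] to that of
   [W p]: directly, or through [f]. *)
Lemma perpendicular_altitude n c s t W F G T nu p :
  star_system n c s t W F G T nu ->
  (p < n)%nat -> (-1) ^ p = -1 ->
  lor (W 0%nat) (W p) <= lor (F p) (W 0%nat) ->
  lor (W 0%nat) (W p) <= lor (F 0%nat) (W p) ->
  exists f, lor f f = 1 /\ det (W 0%nat) (W p) f = 0 /\
    lor (W 0%nat) f < 0 /\ 0 < lor (W p) f /\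
    0 <= lor (G p) f - lor (G 0%nat) f <= 2 /\
    (lor (W p) f + lor (F p) f) - (lor (W 0%nat) f + lor (F 0%nat) f) <=
      (c + 1) * t * (lor (G p) f - lor (G 0%nat) f) /\
    (lor (W p) f + lor (F p) f) - (lor (W 0%nat) f + lor (F 0%nat) f) <=
      (c + 1) * t * (2 - (lor (G p) f - lor (G 0%nat) f)).
Proof.
  intros H Hpn Hp Hfp Hf0.
  pose proof (star_G_unit _ _ _ _ _ _ _ _ _ H) as HGG.
  destruct H as [HW HF Hodd Hc Hs Hcs HWW HFF HWF Hneg HG Hturn Hshift Hsign Hcr Hnu HT].
  assert (Hp1 : (1 <= p)%nat) by (destruct p; [simpl in Hp; lra | lia]).
  assert (HWn : W n = W 0%nat) by (rewrite <- (HW 0%nat); reflexivity).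
  assert (HFn : F n = F 0%nat) by (rewrite <- (HF 0%nat); reflexivity).
  assert (HGW : forall k, lor (G k) (W k) = 0)
    by (intro k; rewrite HG, det_id_2; unfold Rdiv; ring).
  assert (HGF : forall k, lor (G k) (F k) = 0)
    by (intro k; rewrite HG, det_id_1; unfold Rdiv; ring).
  (* As [n] is odd, one period returns to the same altitude with the opposite normal: a
     half-turn. *)
  assert (HGn : forall f, lor (G n) f = - lor (G 0%nat) f).
  { intro f. rewrite !HG, HFn, HWn, Hodd. simpl. unfold Rdiv; ring. }
  (* Normal of the line [W 0], [W p]; a line is perpendicular to it when its normal is orthogonal to
     [z]. *)
  set (z := cross (W 0%nat) (W p)).
  pose proof (Hneg 0%nat p) as HL.
  (* The two distance hypotheses give opposite signs at [p] and [n], so the perpendicular direction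
     is passed in between. *)
  assert (hp : lor (G p) z < 0).
  { rewrite HG, Hp. unfold det, z. rewrite lor_cross_cross, (lor_sym (W p) (W 0%nat)),
      HWW, (lor_sym (F p) (W p)), HWF.
    apply Rmult_lt_reg_r with s; [lra |]. unfold Rdiv; rewrite Rmult_assoc, Rinv_l; nra. }
  assert (hn : 0 < lor (G n) z).
  { rewrite HGn, HG. unfold det, z. rewrite lor_cross_cross, HWW,
      (lor_sym (F 0%nat) (W 0%nat)), HWF. simpl.
    apply Rmult_lt_reg_r with s; [lra |]. rewrite Rmult_0_l.
    unfold Rdiv. rewrite <- Ropp_mult_distr_l, Rmult_assoc, Rinv_l; nra. }
  destruct (sign_change (fun k => lor (G k) z) p (n - p)) as (m & Hm & hm & hm1).
  { lra. } { replace (p + (n - p))%nat with n by lia; exact hn. }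
  simpl in hm, hm1.
  (* Interpolation between the normals on both sides of the sign change; these weights make the
     result orthogonal to [z]. *)
  set (a0 := lor (G (S m)) z) in *. set (b0 := - lor (G m) z).
  assert (Ha0 : 0 < a0) by exact hm1.
  assert (Hb0 : 0 <= b0) by (unfold b0; lra).
  set (f0 := comb a0 (G m) b0 (G (S m))).
  assert (Hf0z : lor f0 z = 0) by (unfold f0; rewrite lor_comb_l; unfold a0, b0; ring).
  (* signs of the vertices with respect to an altitude, shifted back by a period *)
  assert (Hsg : forall q k, (q < k + n < q + n)%nat -> (-1) ^ k * lor (G q) (W k) < 0).
  { intros q k Hk. pose proof (Hsign q (k + n)%nat ltac:(lia)) as A.
    rewrite pow_add, Hodd, HW in A. lra. }
  (* Relative to [f0] the vertices have alternating signs, and the pattern flips between [m] and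
     [m + 1]; this makes the rotation measured by [f] monotone on either side. *)
  assert (Slo : forall k, (k <= m)%nat -> (-1) ^ k * lor f0 (W k) <= 0).
  { intros k Hk. unfold f0; rewrite lor_comb_l.
    assert ((-1) ^ k * lor (G m) (W k) <= 0).
    { destruct (Nat.eq_dec k m) as [-> |]; [rewrite HGW; lra |].
      apply Rlt_le, Hsg; lia. }
    assert ((-1) ^ k * lor (G (S m)) (W k) <= 0).
    { destruct (Nat.eq_dec (k + n) (S m)) as [E |].
      - rewrite <- HW, E, HGW; lra.
      - apply Rlt_le, Hsg; lia. }
    nra. }
  assert (Shi : forall k, (S m <= k <= n)%nat -> 0 <= (-1) ^ k * lor f0 (W k)).
  { intros k Hk. unfold f0; rewrite lor_comb_l.
    assert (0 <= (-1) ^ k * lor (G m) (W k)) by (apply Rlt_le, Hsign; lia).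
    assert (0 <= (-1) ^ k * lor (G (S m)) (W k)).
    { destruct (Nat.eq_dec k (S m)) as [-> |]; [rewrite HGW; lra |].
      apply Rlt_le, Hsign; lia. }
    nra. }
  assert (X0 : lor f0 (W 0%nat) < 0).
  { unfold f0; rewrite lor_comb_l.
    pose proof (Hsg m 0%nat ltac:(lia)) as A. simpl in A.
    assert (lor (G (S m)) (W 0%nat) <= 0).
    { destruct (Nat.eq_dec n (S m)) as [E |].
      - rewrite <- HWn, E, HGW; lra.
      - pose proof (Hsg (S m) 0%nat ltac:(lia)) as B. simpl in B. lra. }
    nra. }
  assert (Xp : 0 < lor f0 (W p)).
  { unfold f0; rewrite lor_comb_l.
    pose proof (Hsg (S m) p ltac:(lia)) as B. rewrite Hp in B.
    destruct (Nat.eq_dec p m) as [E |].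
    - rewrite <- E at 1. rewrite HGW.
      assert (0 < b0) by (unfold b0; rewrite <- E; lra). nra.
    - pose proof (Hsg m p ltac:(lia)) as A. rewrite Hp in A. nra. }
  (* [f0] lies in the plane of [W 0] and [W p] and has opposite signs on them *)
  set (L := - lor (W 0%nat) (W p)) in *.
  assert (Hgram : (L * L - 1) * lor f0 f0 =
     lor f0 (W 0%nat) * lor f0 (W 0%nat) + lor f0 (W p) * lor f0 (W p)
     - 2 * L * (lor f0 (W 0%nat) * lor f0 (W p))).
  { pose proof (det_sqr (W 0%nat) (W p) f0) as A.
    assert (B : det (W 0%nat) (W p) f0 = 0) by (unfold det; rewrite lor_sym; exact Hf0z).
    rewrite B, !HWW, (lor_sym (W p) f0), (lor_sym (W 0%nat) f0) in A. unfold L. lra. }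
  assert (HL0 : 0 < L) by (unfold L; lra).
  (* The altitude line of [W 0] does not contain [W p], so the two vertices differ. *)
  assert (HL1 : 1 < L).
  { pose proof (Hsign 0%nat p ltac:(lia)) as A. rewrite Hp in A.
    pose proof (det_sqr (W 0%nat) (W p) (G 0%nat)) as B.
    rewrite !HWW, HGG, (lor_sym (W 0%nat) (G 0%nat)), HGW,
      (lor_sym (W p) (G 0%nat)) in B.
    fold L in B. assert (lor (W 0%nat) (W p) = - L) as C by (unfold L; ring).
    rewrite C in B. nra. }
  assert (Hq : 0 < lor f0 f0).
  { apply Rmult_lt_reg_l with (L * L - 1); [nra |]. rewrite Hgram.
    set (u := lor f0 (W 0%nat)) in *. set (w := lor f0 (W p)) in *.
    assert (u * w < 0) by nra. assert (L * (u * w) < 0) by nra.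
    pose proof (Rle_0_sqr u). pose proof (Rle_0_sqr w). unfold Rsqr in *. lra. }
  set (r := sqrt (lor f0 f0)).
  assert (Hr : 0 < r) by (apply sqrt_lt_R0; exact Hq).
  assert (Hrr : r * r = lor f0 f0) by (apply sqrt_sqrt; lra).
  set (f := comb (/ r) f0 0 f0).
  assert (Hir : 0 < / r) by (apply Rinv_0_lt_compat; exact Hr).
  assert (Ef : forall u, lor u f = / r * lor f0 u)
    by (intro u; unfold f; rewrite lor_comb_r, (lor_sym u); ring).
  assert (Hff : lor f f = 1).
  { rewrite !Ef, <- Hrr. field; lra. }
  set (g := fun k => lor (G k) f). set (q := fun k => lor (W k) f + lor (F k) f).
  assert (Hstep : forall k, Rabs (q k - q (S k)) <= (c + 1) * t * Rabs (g k - g (S k))).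
  { intro k. unfold q, g. rewrite Hshift, !Rabs_mult, <- RPow_abs.
    replace (Rabs (-1)) with 1 by (rewrite Rabs_left; lra). rewrite pow1, Rmult_1_r.
    destruct (HT k). rewrite (Rabs_right (c + 1)), (Rabs_right (T k)) by lra.
    apply Rmult_le_compat_r; [apply Rabs_pos |]. nra. }
  assert (Hlo : forall k, (k < m)%nat -> g k <= g (S k)).
  { intros k Hk. pose proof (Hturn k f) as E. unfold g.
    pose proof (Slo k ltac:(lia)) as A. pose proof (Slo (S k) ltac:(lia)) as B.
    rewrite !Ef in *. pose proof (Hnu k). cbn [pow] in B.
    assert ((-1) ^ k * nu k * (/ r * lor f0 (W k) - / r * lor f0 (W (S k))) <= 0).
    { replace ((-1) ^ k * nu k * (/ r * lor f0 (W k) - / r * lor f0 (W (S k)))) with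
        (nu k * (/ r) * ((-1) ^ k * lor f0 (W k) - (-1) ^ k * lor f0 (W (S k)))) by ring.
      assert (0 < nu k * / r) by (apply Rmult_lt_0_compat; lra). nra. }
    lra. }
  assert (Hhi : forall k, (S m <= k < n)%nat -> g (S k) <= g k).
  { intros k Hk. pose proof (Hturn k f) as E. unfold g.
    pose proof (Shi k ltac:(lia)) as A. pose proof (Shi (S k) ltac:(lia)) as B.
    rewrite !Ef in *. pose proof (Hnu k). cbn [pow] in B.
    assert (0 <= (-1) ^ k * nu k * (/ r * lor f0 (W k) - / r * lor f0 (W (S k)))).
    { replace ((-1) ^ k * nu k * (/ r * lor f0 (W k) - / r * lor f0 (W (S k)))) with
        (nu k * (/ r) * ((-1) ^ k * lor f0 (W k) - (-1) ^ k * lor f0 (W (S k)))) by ring.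
      assert (0 < nu k * / r) by (apply Rmult_lt_0_compat; lra). nra. }
    lra. }
  assert (Ht : 0 <= (c + 1) * t) by (destruct (HT 0%nat); nra).
  set (a := lor (G m) (G (S m))). pose proof (Hcr m) as Ha. fold a in Ha.
  assert (Eq : lor f0 f0 = a0 * a0 + b0 * b0 + 2 * a0 * b0 * a).
  { unfold f0 at 1. rewrite lor_comb_l. unfold f0. rewrite !lor_comb_r, !HGG,
      (lor_sym (G (S m)) (G m)). fold a. ring. }
  assert (Egm : g m = / r * (a0 + b0 * a)).
  { unfold g. rewrite Ef. unfold f0. rewrite lor_comb_l, HGG,
      (lor_sym (G (S m)) (G m)). fold a. ring. }
  assert (Egm1 : g (S m) = / r * (a0 * a + b0)).
  { unfold g. rewrite Ef. unfold f0. rewrite lor_comb_l, HGG. fold a. ring. }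
  (* [r * r] exceeds the square of [a0 + b0 * a] by [b0 * b0 * (1 - a * a)], and [a] lies between -1
     and 1. *)
  assert (Gm : g m <= 1).
  { rewrite Egm. apply Rmult_le_reg_l with r; [lra |].
    rewrite <- Rmult_assoc, Rinv_r by lra. rewrite Rmult_1_l, Rmult_1_r.
    apply Rsqr_incr_0_var; [unfold Rsqr; rewrite Hrr, Eq | lra].
    assert (0 <= b0 * b0 * (1 - a * a)) by (apply Rmult_le_pos; nra). lra. }
  assert (Gm1 : g (S m) <= 1).
  { rewrite Egm1. apply Rmult_le_reg_l with r; [lra |].
    rewrite <- Rmult_assoc, Rinv_r by lra. rewrite Rmult_1_l, Rmult_1_r.
    apply Rsqr_incr_0_var; [unfold Rsqr; rewrite Hrr, Eq | lra].
    assert (0 <= a0 * a0 * (1 - a * a)) by (apply Rmult_le_pos; nra). lra. }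
  destruct (dominated_variation q g ((c + 1) * t) 0 p) as [D1 D1'].
  { intros k Hk. pose proof (Hlo k ltac:(lia)). split; [lra |].
    eapply Rle_trans; [apply Hstep |]. rewrite Rabs_minus_sym, Rabs_right; lra. }
  destruct (dominated_variation q g ((c + 1) * t) p (m - p)) as [D2 D2'].
  { intros k Hk. pose proof (Hlo k ltac:(lia)). split; [lra |].
    eapply Rle_trans; [apply Hstep |]. rewrite Rabs_minus_sym, Rabs_right; lra. }
  destruct (dominated_variation q (fun k => - g k) ((c + 1) * t) (S m) (n - S m))
    as [D3 D3'].
  { intros k Hk. pose proof (Hhi k ltac:(lia)). split; [lra |].
    eapply Rle_trans; [apply Hstep |]. rewrite Rabs_right; lra. }
  replace (p + (m - p))%nat with m in * by lia.
  replace (S m + (n - S m))%nat with n in * by lia. rewrite Nat.add_0_l in *.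
  assert (Eqn : q n = q 0%nat) by (unfold q; rewrite HWn, HFn; reflexivity).
  assert (Egn : g n = - g 0%nat) by (unfold g; apply HGn).
  rewrite Eqn, Egn in *.
  pose proof (Hstep m) as D4.
  assert (Hb : forall u v, Rabs u <= v -> - v <= u <= v)
    by (intros u v Huv; split; pose proof (Rle_abs u); pose proof (Rle_abs (- u));
        rewrite Rabs_Ropp in *; lra).
  exists f. repeat split.
  - exact Hff.
  - unfold det. rewrite Ef. fold z. rewrite Hf0z. ring.
  - rewrite Ef. nra.
  - rewrite Ef. nra.
  - fold (g p) (g 0%nat). lra.
  - fold (g p) (g 0%nat). lra.
  - fold (g p) (g 0%nat) (q p) (q 0%nat).
    apply Hb in D1'. lra.
  (* Second route: up from [p] to [m], across to [m + 1], down to [n], where [g] equals [- g 0]; [g]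
     is at most 1 at both [m] and [m + 1]. *)
  - fold (g p) (g 0%nat) (q p) (q 0%nat).
    apply Hb in D2'. apply Hb in D3'. apply Hb in D4.
    destruct (Rle_dec (g m) (g (S m))) as [E | E].
    + rewrite Rabs_minus_sym, Rabs_right in D4 by lra. nra.
    + rewrite Rabs_right in D4 by lra. nra.
Qed.

(** * Length estimates for chords and diagonals *)

(** Here [f] lies in the plane of [W 0] and [W p], so their Gram determinant vanishes. *)
Lemma star_perpendicular n c s t W F G T nu p f :
  star_system n c s t W F G T nu -> lor f f = 1 ->
  det (W 0%nat) (W p) f = 0 ->
  let L := - lor (W 0%nat) (W p) in
  L * L - 1 = lor (W 0%nat) f * lor (W 0%nat) f + lor (W p) f * lor (W p) f
              - 2 * L * (lor (W 0%nat) f * lor (W p) f).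
Proof.
  intros H Hf Hd L.
  pose proof (star_WW _ _ _ _ _ _ _ _ _ H) as HWW.
  pose proof (det_sqr (W 0%nat) (W p) f) as A.
  rewrite Hd, !HWW, Hf in A. unfold L. lra.
Qed.

(* The chord [W 0], [W 1] is at least as long as twice the distance from [W 0] to
   the foot of the altitude of [W 1]. *)
Lemma longest_chord_bound n c s t W F G T nu C S :
  star_system n c s t W F G T nu -> (1 < n)%nat ->
  0 < S -> 0 < C -> S * S = C * C - 1 ->
  lor (W 0%nat) (W 1%nat) = - (c * C) ->
  lor (F 1%nat) (W 0%nat) = - C -> lor (F 0%nat) (W 1%nat) = - C ->
  nu 0%nat = S / (c * C - 1) -> T 0%nat = t -> 0 < t ->
  2 * (C * C) - 1 <= c * C.
Proof.
  intros H Hn HS HC HSC HL HF1 HF0 Hnu HT Ht.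
  pose proof (star_c _ _ _ _ _ _ _ _ _ H) as Hc.
  assert (HC1 : 1 < C) by nra. assert (HD : 1 < c * C) by nra.
  destruct (perpendicular_altitude n c s t W F G T nu 1 H Hn)
    as (f & Hff & Hdet & X0 & X1 & _ & _ & Hb); [simpl; ring | nra | nra |].
  pose proof (star_perpendicular _ _ _ _ _ _ _ _ _ _ f H Hff Hdet) as Hg.
  cbv zeta in Hg. rewrite HL in Hg.
  pose proof (star_shift _ _ _ _ _ _ _ _ _ H 0%nat f) as Hsh.
  pose proof (star_turn _ _ _ _ _ _ _ _ _ H 0%nat f) as Htu.
  rewrite HT in Hsh. rewrite Hnu in Htu. simpl in Hsh, Htu.
  set (x := - lor (W 0%nat) f) in *. set (y := lor (W 1%nat) f) in *.
  replace (lor (W 0%nat) f) with (- x) in * by (unfold x; ring).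
  set (g := lor (G 1%nat) f - lor (G 0%nat) f) in *.
  replace (lor (G 0%nat) f - lor (G 1%nat) f) with (- g) in * by (unfold g; ring).
  set (D := c * C) in *.
  (* For one step with [T 0 = t] the displacement is exactly [(c + 1) * t * g], while the other
     route bounds it by [(c + 1) * t * (2 - g)]. *)
  assert (g <= 1).
  { apply Rmult_le_reg_l with ((c + 1) * t); [nra |]. lra. }
  assert (Eg : g * (D - 1) = S * (x + y)).
  { replace g with (- - g) by ring. rewrite Htu. field; lra. }
  assert (0 < x) by lra.
  assert (Exy : (x + y) * (x + y) = (D - 1) * (D + 1 - 2 * (x * y))) by lra.
  assert (Emin : (x - y) * (x - y) = (D + 1) * (D - 1 - 2 * (x * y))) by lra.
  assert (2 * (x * y) <= D - 1).
  { apply Rnot_lt_le; intro. pose proof (Rle_0_sqr (x - y)) as Q. unfold Rsqr in Q.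
    rewrite Emin in Q. nra. }
  assert (S * (x + y) <= D - 1) by nra.
  assert (0 <= S * (x + y)) by (apply Rmult_le_pos; lra).
  assert (A : (S * (x + y)) * (S * (x + y)) <= (D - 1) * (D - 1)) by nra.
  assert (B : (S * (x + y)) * (S * (x + y)) = (S * S) * ((D - 1) * (D + 1 - 2 * (x * y))))
    by (rewrite <- Exy; ring).
  rewrite B, HSC in A.
  assert ((C * C - 1) * (D + 1 - 2 * (x * y)) <= D - 1).
  { apply Rmult_le_reg_l with (D - 1); lra. }
  nra.
Qed.

(* [C] is the hyperbolic cosine of half the side of the regular triangle whose
   altitude has hyperbolic cosine [c]; [E] and [/2] are the values that
   [sqrt (a ^ 2 - f ^ 2)] and [f] take on it, where the estimate is sharp. *)
Lemma regular_triangle_maximizes C S c s x y a b L g :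
  1 < C -> 0 < S -> S * S = C * C - 1 -> c * C = 2 * (C * C) - 1 ->
  0 < s -> c * c = 1 + s * s -> 1 < c ->
  0 < x -> 0 < y -> 0 < a -> 0 < b -> a * a = 1 + x * x -> b * b = 1 + y * y ->
  L = a * b + x * y -> 0 <= g <= 2 ->
  (forall E, 0 < E -> E * E = C * C - / 4 ->
     (c + 1) * (x + y) * E - s * C * (a + b) + s * g / 2 <=
       E * ((c + 1) * ((C - 1) / S) * g) /\
     (c + 1) * (x + y) * E - s * C * (a + b) + s * g / 2 <=
       E * ((c + 1) * ((C - 1) / S) * (2 - g))) ->
  L <= 2 * (C * C) - 1.
Proof.
  intros HC HS HSC Hc Hs Hcs Hc1 Hx Hy Ha Hb Eax Eby EL Hg HE.
  set (E := sqrt (C * C - / 4)).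
  assert (HE0 : 0 < E) by (apply sqrt_lt_R0; nra).
  assert (HEE : E * E = C * C - / 4) by (apply sqrt_sqrt; nra).
  destruct (HE E HE0 HEE) as [H1 H2].
  (* Two consequences of [c * C = 2 * (C * C) - 1] eliminate [c] and [s]; [E] then cancels. *)
  assert (Es : C * s = 2 * E * S).
  { apply sqr_pos_inj; [nra | apply Rmult_lt_0_compat; lra |].
    transitivity (4 * (E * E) * (S * S)); [| ring]. rewrite HEE, HSC.
    transitivity ((c * C) * (c * C) - C * C); [nra |]. rewrite Hc. field. }
  assert (Ec : (c + 1) * C = (2 * C - 1) * (C + 1)) by lra.
  set (u := x + y) in *. set (w := a + b) in *.
  assert (Key : forall r,
    (c + 1) * u * E - s * C * w + s * g / 2 <= E * ((c + 1) * ((C - 1) / S) * r) ->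
    (2 * C - 1) * (C + 1) * u - 2 * S * C * w + S * g <= (2 * C - 1) * S * r).
  { intros r Hr. apply Rmult_le_reg_l with E; [lra |].
    apply Rmult_le_compat_l with (r := C) in Hr; [| lra].
    replace (C * ((c + 1) * u * E - s * C * w + s * g / 2)) with
      (((c + 1) * C) * u * E - (C * s) * C * w + (C * s) * g / 2) in Hr by field.
    replace (C * (E * ((c + 1) * ((C - 1) / S) * r))) with
      (E * (((c + 1) * C) * ((C - 1) / S) * r)) in Hr by (field; lra).
    rewrite Es, Ec in Hr.
    replace ((2 * C - 1) * (C + 1) * ((C - 1) / S)) with ((2 * C - 1) * S) in Hr
      by (apply Rmult_eq_reg_r with S; [| lra]; field_simplify; [nra | lra]).
    lra. }
  apply Key in H1. apply Key in H2.
  (* One bound increases with [g], the other decreases; they meet at [g = 1], which gives this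
     right-hand side. *)
  assert (H : (2 * C - 1) * (C + 1) * u - 2 * S * C * w <= 2 * (C - 1) * S).
  { destruct (Rle_dec g 1) as [Hg1 | Hg1].
    - assert ((2 * C - 2) * S * g <= (2 * C - 2) * S * 1)
        by (apply Rmult_le_compat_l; nra). lra.
    - assert (2 * C * S * 1 <= 2 * C * S * g)
        by (apply Rmult_le_compat_l; nra). lra. }
  (* If [L] were larger, [u] would exceed [2 * S], and [u / w], the hyperbolic tangent of half the
     distance, would exceed [S / C]; together these contradict [H]. *)
  apply Rnot_lt_le; intro HL.
  assert (Eu : u * u = (a - b) * (a - b) + 2 * (L - 1)) by (unfold u; rewrite EL; nra).
  assert (Euw : u * u * (L + 1) = w * w * (L - 1)).
  { unfold u, w. rewrite EL.
    assert (Eab : (a * b) * (a * b) = (1 + x * x) * (1 + y * y))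
      by (rewrite <- Eax, <- Eby; ring).
    set (P := a * b) in *. set (Q := x * y) in *.
    assert (Es2 : x * x + y * y = P * P - Q * Q - 1) by (rewrite Eab; unfold Q; ring).
    replace ((x + y) * (x + y)) with (x * x + y * y + 2 * Q) by (unfold Q; ring).
    replace ((a + b) * (a + b)) with (a * a + b * b + 2 * P) by (unfold P; ring).
    rewrite Eax, Eby.
    replace (1 + x * x + (1 + y * y) + 2 * P) with (x * x + y * y + 2 + 2 * P) by ring.
    rewrite Es2. ring. }
  assert (Hu : 0 < u) by (unfold u; lra). assert (Hw : 0 < w) by (unfold w; lra).
  assert (Hu2 : 2 * S < u).
  { apply Rnot_le_lt; intro. pose proof (Rle_0_sqr (a - b)) as Q. unfold Rsqr in Q.
    assert (u * u <= (2 * S) * (2 * S)) by nra. lra. }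
  assert (Huw : w * S < u * C).
  { apply Rnot_le_lt; intro Hle.
    assert (HuC : 0 <= u * C) by (apply Rmult_le_pos; lra).
    assert (A : (u * C) * (u * C) <= (w * S) * (w * S))
      by (apply Rmult_le_compat; assumption).
    assert (B : (u * u) * (C * C) * (L - 1) <= (u * u) * (L + 1) * (S * S)).
    { rewrite Euw.
      replace (u * u * (C * C) * (L - 1)) with ((L - 1) * ((u * C) * (u * C))) by ring.
      replace (w * w * (L - 1) * (S * S)) with ((L - 1) * ((w * S) * (w * S))) by ring.
      apply Rmult_le_compat_l; [nra | exact A]. }
    rewrite HSC in B. assert (0 < u * u) by nra.
    assert (0 < (u * u) * (L + 1 - 2 * (C * C))) by (apply Rmult_lt_0_compat; lra).
    lra. }
  assert (2 * C * (w * S) < 2 * C * (u * C)) by (apply Rmult_lt_compat_l; lra).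
  assert ((2 * S) * (C - 1) < u * (C - 1)) by (apply Rmult_lt_compat_r; lra).
  lra.
Qed.

(** Cauchy-Schwarz for [(E, 1/2)], of length [C], and [(e, g)], of length [a]. *)
Lemma planar_cauchy e g a E C :
  0 < a -> 0 < C -> E * E = C * C - / 4 -> e * e + g * g = a * a ->
  E * e + g / 2 <= C * a.
Proof.
  intros Ha HC HE Hg.
  apply Rsqr_incr_0_var; [| nra]. unfold Rsqr.
  replace ((C * a) * (C * a)) with ((E * E + / 4) * (e * e + g * g))
    by (rewrite Hg, HE; ring).
  pose proof (Rle_0_sqr (E * g - e / 2)) as Q. unfold Rsqr in Q. lra.
Qed.

(** Bounding the components of [f] at [W 0] and [W p] by [planar_cauchy] turns the displacement
    bounds into the hypotheses of [regular_triangle_maximizes]. *)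
Lemma diagonal_bound n c s W F G T nu p C S :
  1 < C -> 0 < S -> S * S = C * C - 1 -> c * C = 2 * (C * C) - 1 ->
  star_system n c s ((C - 1) / S) W F G T nu ->
  (p < n)%nat -> (-1) ^ p = -1 ->
  lor (W 0%nat) (W p) <= lor (F p) (W 0%nat) ->
  lor (W 0%nat) (W p) <= lor (F 0%nat) (W p) ->
  - lor (W 0%nat) (W p) <= 2 * (C * C) - 1.
Proof.
  intros HC HS HSC HcC H Hpn Hp H1 H2.
  destruct (perpendicular_altitude _ _ _ _ _ _ _ _ _ p H Hpn Hp H1 H2)
    as (f & Hff & Hdet & X0 & X1 & Hg & Hb1 & Hb2).
  pose proof (star_perpendicular _ _ _ _ _ _ _ _ _ _ f H Hff Hdet) as Hgr.
  cbv zeta in Hgr.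
  destruct H as [HW HF Hodd Hc Hs Hcs HWW HFF HWF Hneg HG Hturn Hshift Hsign Hcr Hnu HT].
  pose proof (Hneg 0%nat p) as HL.
  set (L := - lor (W 0%nat) (W p)) in *.
  (* Component of [f] along the altitude: [(F k - c * W k) / s] is the unit tangent at [W k] towards
     the foot. *)
  set (e := fun k => (lor (F k) f - c * lor (W k) f) / s).
  assert (Ee : forall k, lor (F k) f = c * lor (W k) f + s * e k)
    by (intro k; unfold e; field; lra).
  (* The unit vector [f] in the orthonormal frame of [W k], this tangent and [G k]; only [W k] is
     timelike. *)
  assert (Hframe : forall k, e k * e k + lor (G k) f * lor (G k) f
                             = 1 + lor (W k) f * lor (W k) f).
  { intro k. rewrite HG.
    pose proof (det_sqr (F k) (W k) f) as A.
    rewrite HFF, HWW, Hff, (lor_sym (F k) (W k)), HWF, Ee in A.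
    set (y := lor (W k) f) in *. set (ek := e k) in *.
    transitivity (ek * ek + ((-1) ^ k * (-1) ^ k) *
                  (det (F k) (W k) f * det (F k) (W k) f) / (s * s)); [field; lra |].
    rewrite pow_m1_sqr, A.
    apply Rmult_eq_reg_r with (s * s); [| nra]. field_simplify; [| lra].
    replace (c ^ 2) with (1 + s ^ 2) by (simpl; lra). ring. }
  set (x := - lor (W 0%nat) f). set (y := lor (W p) f) in *.
  assert (Ex : lor (W 0%nat) f = - x) by (unfold x; ring).
  assert (Hx : 0 < x) by (unfold x; lra).
  pose proof (Hframe 0%nat) as F0. pose proof (Hframe p) as Fp.
  rewrite !Ee in Hb1, Hb2. fold y in Hb1, Hb2, Fp.
  rewrite Ex in Hb1, Hb2, F0, Hgr. fold y in Hgr.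
  set (a := sqrt (1 + x * x)). set (b := sqrt (1 + y * y)).
  assert (Ha : 0 < a) by (apply sqrt_lt_R0; nra).
  assert (Hb : 0 < b) by (apply sqrt_lt_R0; nra).
  assert (Eax : a * a = 1 + x * x) by (apply sqrt_sqrt; nra).
  assert (Eby : b * b = 1 + y * y) by (apply sqrt_sqrt; nra).
  set (g := lor (G p) f - lor (G 0%nat) f) in *.
  apply (regular_triangle_maximizes C S c s x y a b L g); auto.
  (* Addition formula: the vertices lie on opposite sides of the perpendicular with normal [f], so
     their distances to it add up. *)
  - assert (Hxy : 0 < x * y) by (apply Rmult_lt_0_compat; lra).
    assert (HLxy : 0 < L - x * y).
    { assert (0 < L * (L - 2 * (x * y))) by nra.
      assert (0 < L - 2 * (x * y)); [| lra].
      apply Rmult_lt_reg_l with L; [unfold L; lra | lra]. }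
    enough (a * b = L - x * y) by lra.
    apply sqr_pos_inj; [apply Rmult_lt_0_compat; lra | exact HLxy |].
    transitivity ((a * a) * (b * b)); [ring |]. rewrite Eax, Eby. nra.
  - intros E HE HEE.
    pose proof (planar_cauchy (- e p) (lor (G p) f) b E C Hb ltac:(lra) HEE) as Cp.
    pose proof (planar_cauchy (e 0%nat) (- lor (G 0%nat) f) a E C Ha ltac:(lra) HEE) as C0.
    specialize (Cp ltac:(lra)). specialize (C0 ltac:(lra)).
    assert (A : s * (E * (e 0%nat - e p) + g / 2) <= s * (C * (a + b)))
      by (apply Rmult_le_compat_l; unfold g; lra).
    assert (B1 := Rmult_le_compat_l E _ _ ltac:(lra) Hb1).
    assert (B2 := Rmult_le_compat_l E _ _ ltac:(lra) Hb2).
    split; lra.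
Qed.

(** * From the Klein disk to the hyperboloid *)

Lemma arcosh_lt a b : 1 <= a -> a < b -> arcosh a < arcosh b.
Proof.
  intros Ha Hab. apply ln_increasing.
  - pose proof (sqrt_pos (a * a - 1)); lra.
  - assert (sqrt (a * a - 1) < sqrt (b * b - 1)) by (apply sqrt_lt_1; nra). lra.
Qed.

Lemma arcosh_le_inv a b : 1 <= b -> arcosh a <= arcosh b -> a <= b.
Proof.
  intros Hb H. apply Rnot_lt_le; intro Hba.
  pose proof (arcosh_lt b a Hb Hba). lra.
Qed.

Lemma cosh_arcosh z : 1 <= z -> cosh (arcosh z) = z.
Proof.
  intro Hz. unfold cosh, arcosh.
  pose proof (sqrt_pos (z * z - 1)) as Hp.
  assert (Hs : sqrt (z * z - 1) * sqrt (z * z - 1) = z * z - 1)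
    by (apply sqrt_sqrt; nra).
  rewrite exp_Ropp, exp_ln by lra.
  apply Rmult_eq_reg_r with (2 * (z + sqrt (z * z - 1))); [| lra].
  field_simplify; [| lra]. simpl. nra.
Qed.

Definition sqnorm (p : pt) : R := fst p * fst p + snd p * snd p.
Definition dot (p q : pt) : R := fst p * fst q + snd p * snd q.
Definition scale (p : pt) : R := sqrt (1 - sqnorm p).

(** The point [(x, y, 1)] rescaled to Minkowski norm -1. The factor is positive in the disk, so
    orientations carry over. *)
Definition lift (p : pt) : vec :=
  Vec (fst p / scale p) (snd p / scale p) (1 / scale p).

Lemma scale_pos p : in_disk p -> 0 < scale p.
Proof. intro H. apply sqrt_lt_R0. unfold in_disk in H. unfold sqnorm. lra. Qed.

Lemma scale_sqr p : in_disk p -> scale p * scale p = 1 - sqnorm p.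
Proof. intro H. apply sqrt_sqrt. unfold in_disk in H. unfold sqnorm. lra. Qed.

Lemma lor_lift p q : in_disk p -> in_disk q ->
  lor (lift p) (lift q) = - ((1 - dot p q) / (scale p * scale q)).
Proof.
  intros Hp Hq. pose proof (scale_pos p Hp). pose proof (scale_pos q Hq).
  unfold lor, lift, dot; simpl. field; lra.
Qed.

Lemma lor_lift_self p : in_disk p -> lor (lift p) (lift p) = -1.
Proof.
  intro Hp. rewrite lor_lift, scale_sqr by assumption.
  pose proof (scale_pos p Hp). pose proof (scale_sqr p Hp).
  unfold dot. fold (sqnorm p). field. nra.
Qed.

Lemma dot_lt_1 p q : in_disk p -> in_disk q -> 0 < 1 - dot p q.
Proof.
  unfold in_disk, dot. destruct p as [a b], q as [c d]; simpl. intros.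
  pose proof (Rle_0_sqr (a - c)). pose proof (Rle_0_sqr (b - d)). unfold Rsqr in *. lra.
Qed.

Lemma lor_lift_le p q : in_disk p -> in_disk q -> 1 <= - lor (lift p) (lift q).
Proof.
  intros Hp Hq. rewrite lor_lift, Ropp_involutive by assumption.
  pose proof (scale_pos p Hp). pose proof (scale_pos q Hq).
  pose proof (scale_sqr p Hp) as Ep. pose proof (scale_sqr q Hq) as Eq.
  pose proof (dot_lt_1 p q Hp Hq) as Hd.
  assert (0 < scale p * scale q) by (apply Rmult_lt_0_compat; assumption).
  apply Rmult_le_reg_r with (scale p * scale q); [assumption |].
  unfold Rdiv; rewrite Rmult_assoc, Rinv_l, Rmult_1_l, Rmult_1_r by lra.
  apply Rsqr_incr_0_var; [| lra]. unfold Rsqr.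
  replace (scale p * scale q * (scale p * scale q)) with
    ((scale p * scale p) * (scale q * scale q)) by ring.
  rewrite Ep, Eq. unfold in_disk in *. unfold sqnorm, dot in *.
  destruct p as [a b], q as [c d]; simpl in *.
  (* the difference is |p-q|^2 - det(p, q-p)^2, and det(p, q-p)^2 <= |p|^2 |q-p|^2 *)
  assert (I : (1 - (a * c + b * d)) * (1 - (a * c + b * d))
    - (1 - (a * a + b * b)) * (1 - (c * c + d * d))
    = (1 - (a * a + b * b)) * ((c - a) * (c - a) + (d - b) * (d - b))
      + (a * (c - a) + b * (d - b)) * (a * (c - a) + b * (d - b))) by ring.
  assert (0 <= (1 - (a * a + b * b)) * ((c - a) * (c - a) + (d - b) * (d - b)))
    by (apply Rmult_le_pos; [lra | apply Rplus_le_le_0_compat; apply Rle_0_sqr]).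
  pose proof (Rle_0_sqr (a * (c - a) + b * (d - b))). unfold Rsqr in *. lra.
Qed.

Lemma hdist_lift p q : in_disk p -> in_disk q ->
  hdist p q = arcosh (- lor (lift p) (lift q)).
Proof.
  intros Hp Hq. rewrite lor_lift, Ropp_involutive by assumption.
  unfold hdist, scale, sqnorm, dot. unfold in_disk in *. rewrite sqrt_mult; [| lra | lra].
  reflexivity.
Qed.

Lemma det_lift p q r : in_disk p -> in_disk q -> in_disk r ->
  det (lift p) (lift q) (lift r) = orient p q r / (scale p * scale q * scale r).
Proof.
  intros Hp Hq Hr.
  pose proof (scale_pos p Hp). pose proof (scale_pos q Hq). pose proof (scale_pos r Hr).
  unfold det, lor, cross, lift, orient; simpl. field. lra.
Qed.

Lemma det_lift_pos p q r : in_disk p -> in_disk q -> in_disk r ->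
  0 < orient p q r -> 0 < det (lift p) (lift q) (lift r).
Proof.
  intros Hp Hq Hr H. rewrite det_lift by assumption.
  apply Rdiv_lt_0_compat; [exact H |].
  repeat apply Rmult_lt_0_compat; apply scale_pos; assumption.
Qed.

Lemma det_lift_neg p q r : in_disk p -> in_disk q -> in_disk r ->
  orient p q r < 0 -> det (lift p) (lift q) (lift r) < 0.
Proof.
  intros Hp Hq Hr H. rewrite det_swap, <- Ropp_0. apply Ropp_lt_contravar.
  apply det_lift_pos; try assumption. unfold orient in *. lra.
Qed.

Definition in_segment (a b f : pt) : Prop :=
  exists t, 0 < t < 1 /\ fst f = fst a + t * (fst b - fst a) /\
                         snd f = snd a + t * (snd b - snd a).

Lemma orient_in_segment x y a b f : in_segment a b f ->
  0 <= orient x y a -> 0 <= orient x y b -> 0 < orient x y a + orient x y b ->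
  0 < orient x y f.
Proof.
  intros (t & Ht & E1 & E2) Ha Hb Hab.
  assert (E : orient x y f = (1 - t) * orient x y a + t * orient x y b)
    by (unfold orient; rewrite E1, E2; ring).
  rewrite E. destruct Ha as [Ha | Ha].
  - assert (0 < (1 - t) * orient x y a) by (apply Rmult_lt_0_compat; lra). nra.
  - rewrite <- Ha in *. nra.
Qed.

Lemma in_disk_segment a b t : in_disk a -> in_disk b -> 0 <= t <= 1 ->
  in_disk (fst a + t * (fst b - fst a), snd a + t * (snd b - snd a)).
Proof.
  intros Ha Hb Ht. unfold in_disk in *. destruct a as [a1 a2], b as [b1 b2]; simpl in *.
  assert (I : (a1 + t * (b1 - a1)) * (a1 + t * (b1 - a1))
      + (a2 + t * (b2 - a2)) * (a2 + t * (b2 - a2))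
    = (1 - t) * (a1 * a1 + a2 * a2) + t * (b1 * b1 + b2 * b2)
      - t * (1 - t) * ((b1 - a1) * (b1 - a1) + (b2 - a2) * (b2 - a2))) by ring.
  rewrite I.
  assert (0 <= t * (1 - t) * ((b1 - a1) * (b1 - a1) + (b2 - a2) * (b2 - a2)))
    by (apply Rmult_le_pos; [nra | apply Rplus_le_le_0_compat; apply Rle_0_sqr]).
  set (u := 1 - (a1 * a1 + a2 * a2)). set (w := 1 - (b1 * b1 + b2 * b2)).
  assert (Hu : 0 < u) by (unfold u; lra). assert (Hw : 0 < w) by (unfold w; lra).
  enough (0 < (1 - t) * u + t * w) by (unfold u, w in *; lra).
  destruct (Rle_lt_dec t 0); nra.
Qed.

(** First-order condition at an interior minimum: near 0 the linear term dominates the quadratic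
    one. *)
Lemma linear_part_zero l q r : 0 < r ->
  (forall e, - r <= e <= r -> 0 <= e * l + e * e * q) -> l = 0.
Proof.
  intros Hr H.
  assert (A : forall l', (forall e, 0 <= e <= r -> 0 <= e * l' + e * e * q) -> 0 <= l').
  { intros l' H'. apply Rnot_lt_le; intro Hl.
    pose proof (Rabs_pos q) as Hq.
    set (e := Rmin r (- l' / (2 * (Rabs q + 1)))).
    assert (Hd : 0 < - l' / (2 * (Rabs q + 1))) by (apply Rdiv_lt_0_compat; lra).
    assert (He : 0 < e) by (apply Rmin_glb_lt; assumption).
    assert (He' : e <= r) by apply Rmin_l.
    assert (Hel : e * (2 * (Rabs q + 1)) <= - l').
    { replace (- l') with (- l' / (2 * (Rabs q + 1)) * (2 * (Rabs q + 1)))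
        by (field; lra).
      apply Rmult_le_compat_r; [lra | apply Rmin_r]. }
    pose proof (H' e ltac:(lra)) as C. pose proof (Rle_abs q).
    assert (e * q <= e * Rabs q) by nra.
    assert (e * (l' + e * q) < 0) by (assert (l' + e * q < 0) by nra; nra).
    lra. }
  apply Rle_antisym.
  - enough (0 <= - l) by lra. apply A. intros e He.
    pose proof (H (- e) ltac:(lra)). lra.
  - apply A. intros e He. apply H. lra.
Qed.

(** Minimality along the line gives the orthogonality equation [L]; in Minkowski terms it is the
    hyperbolic Pythagorean theorem for the right triangles with vertices [p], [f] and an end of the
    side. *)
Lemma foot_orthogonal p a b f : in_disk p -> in_disk a -> in_disk b ->
  in_segment a b f -> is_foot p (line_through a b) f ->
  in_disk f /\ forall g, in_disk g -> (g = a \/ g = b) ->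
    lor (lift p) (lift g) = - lor (lift p) (lift f) * lor (lift f) (lift g).
Proof.
  intros Hp Ha Hb (t & Ht & F1 & F2) (Hf & _ & Hmin).
  split; [exact Hf |].
  set (e := (fst b - fst a, snd b - snd a)).
  assert (L : (1 - dot p f) * dot f e = dot p e * (1 - sqnorm f)).
  (* This is exactly the linear coefficient in the squared, cross-multiplied comparison of
     distances. *)
  { enough (2 * (1 - dot p f) * ((1 - dot p f) * dot f e - dot p e * (1 - sqnorm f)) = 0)
      by (pose proof (dot_lt_1 p f Hp Hf); nra).
    apply linear_part_zero with
      (q := dot p e * dot p e * (1 - sqnorm f)
            + (1 - dot p f) * (1 - dot p f) * dot e e)
      (r := Rmin t (1 - t)); [apply Rmin_glb_lt; lra |].
    intros d Hd.
    pose proof (Rmin_l t (1 - t)). pose proof (Rmin_r t (1 - t)).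
    set (g := (fst a + (t + d) * (fst b - fst a), snd a + (t + d) * (snd b - snd a))).
    assert (Hg : in_disk g) by (apply in_disk_segment; auto; lra).
    assert (Hl : on_line (line_through a b) g)
      by (unfold on_line, line_through, g; simpl; ring).
    pose proof (Hmin g Hg Hl) as M.
    rewrite !hdist_lift in M by assumption.
    apply arcosh_le_inv in M; [| apply lor_lift_le; assumption].
    rewrite !lor_lift, !Ropp_involutive in M by assumption.
    pose proof (scale_pos p Hp). pose proof (scale_pos f Hf) as Sf.
    pose proof (scale_pos g Hg) as Sg.
    apply Rmult_le_compat_r with (r := scale p * scale f * scale g) in M.
    2:{ repeat apply Rmult_le_pos; lra. }
    replace ((1 - dot p f) / (scale p * scale f) * (scale p * scale f * scale g))
      with ((1 - dot p f) * scale g) in M by (field; lra).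
    replace ((1 - dot p g) / (scale p * scale g) * (scale p * scale f * scale g))
      with ((1 - dot p g) * scale f) in M by (field; lra).
    pose proof (dot_lt_1 p f Hp Hf).
    assert (M2 : ((1 - dot p f) * scale g) * ((1 - dot p f) * scale g)
              <= ((1 - dot p g) * scale f) * ((1 - dot p g) * scale f)).
    { apply Rmult_le_compat; try assumption; apply Rmult_le_pos; lra. }
    replace ((1 - dot p f) * scale g * ((1 - dot p f) * scale g)) with
      ((1 - dot p f) * (1 - dot p f) * (scale g * scale g)) in M2 by ring.
    replace ((1 - dot p g) * scale f * ((1 - dot p g) * scale f)) with
      ((1 - dot p g) * (1 - dot p g) * (scale f * scale f)) in M2 by ring.
    rewrite !scale_sqr in M2 by assumption.
    assert (E1 : dot p g = dot p f + d * dot p e)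
      by (unfold dot, g, e; simpl; rewrite F1, F2; ring).
    assert (E2 : sqnorm g = sqnorm f + 2 * d * dot f e + d * d * dot e e)
      by (unfold sqnorm, dot, g, e; simpl; rewrite F1, F2; ring).
    rewrite E1, E2 in M2. lra. }
  assert (K : forall d g, in_disk g -> dot p g = dot p f + d * dot p e ->
     dot f g = sqnorm f + d * dot f e ->
     lor (lift p) (lift g) = - lor (lift p) (lift f) * lor (lift f) (lift g)).
  { intros d g Hg E1 E2. rewrite !lor_lift, E1, E2 by assumption.
    pose proof (scale_pos p Hp). pose proof (scale_pos f Hf) as Sf.
    pose proof (scale_pos g Hg) as Sg. pose proof (scale_sqr f Hf) as Q.
    transitivity (- (((1 - dot p f) - d * dot p e) * (scale f * scale f))
                  / (scale p * scale g * (scale f * scale f))); [field; lra |].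
    transitivity (- ((1 - dot p f) * (1 - (sqnorm f + d * dot f e)))
                  / (scale p * scale g * (scale f * scale f))); [| field; lra].
    pose proof (f_equal (Rmult d) L). f_equal. rewrite Q. lra. }
  intros g Hg [-> | ->].
  - apply (K (- t)); [exact Hg | |]; unfold sqnorm, dot, e; simpl; rewrite F1, F2; ring.
  - apply (K (1 - t)); [exact Hg | |]; unfold sqnorm, dot, e; simpl; rewrite F1, F2; ring.
Qed.

(** * Cyclic indices and orientation in a convex polygon *)

Definition periodic {A : Type} (n : nat) (p : nat -> A) : Prop :=
  forall i, p (i + n)%nat = p i.

Lemma periodic_mult {A : Type} n (p : nat -> A) : periodic n p ->
  forall i m, p (i + m * n)%nat = p i.
Proof.
  intros H i m; induction m as [| m IH]; [f_equal; lia |].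
  replace (i + S m * n)%nat with (i + m * n + n)%nat by lia.
  rewrite H; exact IH.
Qed.

Lemma periodic_mod {A : Type} n (v : nat -> A) : periodic n (fun i => v (i mod n)%nat).
Proof.
  intro i; simpl. rewrite <- (Nat.mul_1_l n) at 1. now rewrite Nat.Div0.mod_add.
Qed.

Lemma mod_add_neq n i a b : (a < b < a + n)%nat -> ((i + a) mod n <> (i + b) mod n)%nat.
Proof.
  intros Hab E.
  pose proof (Nat.div_mod_eq (i + a) n) as Ea. pose proof (Nat.div_mod_eq (i + b) n) as Eb.
  rewrite E in Ea.
  set (r := ((i + b) mod n)%nat) in *.
  set (qa := ((i + a) / n)%nat) in *. set (qb := ((i + b) / n)%nat) in *.
  assert (b - a = n * qb - n * qa)%nat by lia.
  destruct (Nat.le_gt_cases qb qa); nia.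
Qed.

Lemma orient_rot p q r : orient p q r = orient q r p.
Proof. unfold orient; ring. Qed.

Lemma orient_plucker p q a c d :
  orient p q a * orient p c d - orient p q c * orient p a d
  + orient p q d * orient p a c = 0.
Proof. unfold orient; ring. Qed.

(** The definition only covers triples containing an edge. The three-term Plucker relation, with [i]
    and [i + 1] fixed, extends positivity to all triples by induction on the gap. *)
Lemma convex_polygon_orient n v : convex_polygon n v ->
  forall i a b, (0 < a < b)%nat -> (b < n)%nat ->
  0 < orient (v (i mod n)%nat) (v ((i + a) mod n)%nat) (v ((i + b) mod n)%nat).
Proof.
  intros (Hn & _ & _ & Ho) i a b Hab Hb.
  assert (Edge : forall k d, (2 <= d < n)%nat ->
    0 < orient (v (k mod n)%nat) (v ((k + 1) mod n)%nat) (v ((k + d) mod n)%nat)).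
  { intros k d Hd. rewrite <- (Nat.Div0.add_mod_idemp_l k 1).
    apply Ho.
    - apply Nat.mod_upper_bound; lia.
    - apply Nat.mod_upper_bound; lia.
    - rewrite <- (Nat.add_0_r k) at 2. apply not_eq_sym, mod_add_neq; lia.
    - rewrite Nat.Div0.add_mod_idemp_l. apply not_eq_sym, mod_add_neq; lia. }
  assert (Next : forall d, (1 <= d)%nat -> (d + 1 < n)%nat ->
    0 < orient (v (i mod n)%nat) (v ((i + d) mod n)%nat) (v ((i + (d + 1)) mod n)%nat)).
  { intros d Hd Hd'. rewrite orient_rot.
    pose proof (Edge (i + d)%nat (n - d)%nat ltac:(lia)) as A.
    replace (i + d + (n - d))%nat with (i + n)%nat in A by lia.
    rewrite (periodic_mod n v i) in A.
    replace (i + (d + 1))%nat with (i + d + 1)%nat by lia. exact A. }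
  destruct (Nat.eq_dec a 1) as [-> | Ha]; [apply Edge; lia |].
  replace b with (a + 1 + (b - a - 1))%nat in * by lia.
  generalize dependent (b - a - 1)%nat. intro d.
  induction d as [| d IH]; intros Hab Hb.
  - rewrite Nat.add_0_r. apply Next; lia.
  - specialize (IH ltac:(lia) ltac:(lia)).
    pose proof (Next (a + 1 + d)%nat ltac:(lia) ltac:(lia)) as Hcd.
    replace (a + 1 + d + 1)%nat with (a + 1 + S d)%nat in Hcd by lia.
    pose proof (Edge i a ltac:(lia)) as Qa.
    pose proof (Edge i (a + 1 + d)%nat ltac:(lia)) as Qc.
    pose proof (Edge i (a + 1 + S d)%nat ltac:(lia)) as Qd.
    pose proof (orient_plucker (v (i mod n)%nat) (v ((i + 1) mod n)%nat)
      (v ((i + a) mod n)%nat) (v ((i + (a + 1 + d)) mod n)%nat)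
      (v ((i + (a + 1 + S d)) mod n)%nat)) as P.
    eapply Rmult_lt_reg_l; [exact Qc |]. rewrite Rmult_0_r.
    assert (U1 := Rmult_lt_0_compat _ _ Qa Hcd).
    assert (U2 := Rmult_lt_0_compat _ _ Qd IH). lra.
Qed.

(** * Altitudes of a reduced polygon *)

(* Vertices [p] and feet [q] of the altitudes of a reduced [(2h+1)]-gon, both
   indexed periodically; [c] is the hyperbolic cosine of the thickness. *)
Record altitudes (h : nat) (c : R) (p q : nat -> pt) : Prop := {
  alt_h : (1 <= h)%nat;
  alt_p : periodic (2 * h + 1) p;
  alt_q : periodic (2 * h + 1) q;
  alt_p_disk : forall i, in_disk (p i);
  alt_q_disk : forall i, in_disk (q i);
  alt_orient : forall i a b, (0 < a < b)%nat -> (b < 2 * h + 1)%nat ->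
    0 < orient (p i) (p (i + a)%nat) (p (i + b)%nat);
  alt_segment : forall i, in_segment (p (i + h)%nat) (p (i + (h + 1))%nat) (q i);
  alt_c : 1 < c;
  alt_length : forall i, lor (lift (p i)) (lift (q i)) = - c;
  alt_orth_l : forall i, lor (lift (p i)) (lift (p (i + h)%nat)) =
                         c * lor (lift (q i)) (lift (p (i + h)%nat));
  alt_orth_r : forall i, lor (lift (p i)) (lift (p (i + (h + 1))%nat)) =
                         c * lor (lift (q i)) (lift (p (i + (h + 1))%nat))
}.

(** The thickness is unique, so the existential value in the definition is [D]; the feet are
    gathered into a function by finite choice. *)
Lemma ordinary_reduced_altitudes n v D :
  ordinary_reduced n v -> is_thickness (hull n v) D ->
  exists h q, (n = 2 * h + 1)%nat /\ altitudes h (cosh D) (fun i => v (i mod n)%nat) q /\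
    forall i, exists a b, (a < n)%nat /\ (b < n)%nat /\ in_segment (v a) (v b) (q i).
Proof.
  intros (Hodd & Hcv & D' & HD' & Hf) HD.
  assert (D' = D) as ->.
  { destruct HD' as [(H1 & A1 & B1) C1], HD as [(H2 & A2 & B2) C2].
    apply Rle_antisym; eauto. }
  destruct Hodd as [h Hh].
  pose proof Hcv as (Hn & Hdisk & _ & _).
  pose proof (convex_polygon_orient n v Hcv) as Ho.
  assert (Hm : forall i, (i mod n < n)%nat) by (intro; apply Nat.mod_upper_bound; lia).
  assert (Eh : ((n - 1) / 2 = h)%nat)
    by (rewrite Hh; replace (2 * h + 1 - 1)%nat with (h * 2)%nat by lia;
        apply Nat.div_mul; lia).
  assert (Eh1 : ((n + 1) / 2 = h + 1)%nat)
    by (rewrite Hh; replace (2 * h + 1 + 1)%nat with ((h + 1) * 2)%nat by lia;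
        apply Nat.div_mul; lia).
  rewrite Eh, Eh1 in Hf.
  set (good := fun i f =>
    is_foot (v i) (line_through (v ((i + h) mod n)%nat) (v ((i + (h + 1)) mod n)%nat)) f
    /\ in_segment (v ((i + h) mod n)%nat) (v ((i + (h + 1)) mod n)%nat) f
    /\ hdist (v i) f = D).
  assert (Choice : forall m, (m <= n)%nat ->
    exists q, forall i, (i < m)%nat -> good i (q i)).
  { induction m as [| m IH]; intro Hmn.
    - exists v; intros; lia.
    - destruct IH as [q Hq]; [lia |].
      destruct (Hf m ltac:(lia)) as (f & F1 & F2 & F3).
      exists (fun i => if Nat.eq_dec i m then f else q i). intros i Hi.
      destruct (Nat.eq_dec i m) as [-> | Hne]; [exact (conj F1 (conj F2 F3)) |].
      apply Hq; lia. }
  destruct (Choice n (le_n n)) as [q Hq].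
  exists h, (fun i => q (i mod n)%nat). split; [exact Hh |].
  assert (Hgood : forall i, in_disk (q (i mod n)%nat) /\
    in_segment (v ((i + h) mod n)%nat) (v ((i + (h + 1)) mod n)%nat) (q (i mod n)%nat) /\
    hdist (v (i mod n)%nat) (q (i mod n)%nat) = D /\
    forall g, g = v ((i + h) mod n)%nat \/ g = v ((i + (h + 1)) mod n)%nat ->
      lor (lift (v (i mod n)%nat)) (lift g) =
      - lor (lift (v (i mod n)%nat)) (lift (q (i mod n)%nat))
        * lor (lift (q (i mod n)%nat)) (lift g)).
  { intro i. destruct (Hq (i mod n)%nat (Hm i)) as (G1 & G2 & G3).
    rewrite !Nat.Div0.add_mod_idemp_l in G1, G2.
    destruct (foot_orthogonal _ _ _ _ (Hdisk _ (Hm i)) (Hdisk _ (Hm (i + h)%nat))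
      (Hdisk _ (Hm (i + (h + 1))%nat)) G2 G1) as [K1 K2].
    repeat split; auto. intros g Hg. apply K2; [| exact Hg].
    destruct Hg as [-> | ->]; apply Hdisk, Hm. }
  assert (Hlen : forall i,
    lor (lift (v (i mod n)%nat)) (lift (q (i mod n)%nat)) = - cosh D).
  { intro i. destruct (Hgood i) as (K1 & _ & K3 & _).
    rewrite hdist_lift in K3 by auto. rewrite <- K3, cosh_arcosh; [ring |].
    apply lor_lift_le; auto. }
  split; [| intro i; destruct (Hgood i) as (_ & K & _); do 2 eexists; eauto].
  assert (HcD : 1 <= cosh D).
  { rewrite <- (Ropp_involutive (cosh D)), <- (Hlen 0%nat).
    apply lor_lift_le; [auto | apply Hgood]. }
  constructor; try (intros; apply Hgood; auto).
  - lia.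
  - rewrite <- Hh. apply periodic_mod.
  - rewrite <- Hh. apply periodic_mod.
  - auto.
  - rewrite <- Hh. apply Ho.
  (* If [cosh D] were 1, the vertex [w] would be its own foot and the Gram determinant would vanish,
     although [f] lies off the line [w u]. *)
  - destruct HcD as [HcD | HcD]; [exact HcD |]. exfalso.
    set (w := v (0 mod n)%nat). set (f := q (0 mod n)%nat).
    set (u := v ((0 + h) mod n)%nat).
    destruct (Hgood 0%nat) as (K1 & K2 & _ & K4).
    assert (A : 0 < orient w u f).
    { eapply orient_in_segment; [exact K2 | | |]; fold u w.
      - replace (orient w u u) with 0 by (unfold orient; ring). lra.
      - left. apply (Ho 0%nat h (h + 1)%nat); lia.
      - replace (orient w u u) with 0 by (unfold orient; ring). rewrite Rplus_0_l.
        apply (Ho 0%nat h (h + 1)%nat); lia. }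
    apply det_lift_pos in A; unfold w, u; auto. fold w u in A.
    pose proof (det_sqr (lift w) (lift u) (lift f)) as B.
    specialize (K4 u (or_introl eq_refl)). fold w f in K4.
    pose proof (Hlen 0%nat) as L. fold w f in L. rewrite L, <- HcD in K4.
    rewrite (lor_sym (lift u) (lift f)), K4, L, <- HcD, !lor_lift_self in B;
      unfold w, u; auto. fold w f u in B. nra.
  - exact Hlen.
  - intro i. destruct (Hgood i) as (_ & _ & _ & K4).
    rewrite (K4 _ (or_introl eq_refl)), Hlen. ring.
  - intro i. destruct (Hgood i) as (_ & _ & _ & K4).
    rewrite (K4 _ (or_intror eq_refl)), Hlen. ring.
Qed.

(** The altitude from [p i] ends inside the opposite side, so it leaves the next [h] vertices on one
    side and, by [altitude_right], the other [h] on the other. *)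
Lemma altitude_left h c p q : altitudes h c p q ->
  forall i a, (0 < a <= h)%nat -> 0 < orient (q i) (p i) (p (i + a)%nat).
Proof.
  intros A i a Ha. rewrite orient_rot.
  pose proof (alt_orient _ _ _ _ A i) as Ho.
  apply orient_in_segment with (1 := alt_segment _ _ _ _ A i).
  - destruct (Nat.eq_dec a h) as [-> |].
    + unfold orient; lra.
    + left; apply Ho; lia.
  - left; apply Ho; lia.
  - assert (0 < orient (p i) (p (i + a)%nat) (p (i + (h + 1))%nat)) by (apply Ho; lia).
    destruct (Nat.eq_dec a h) as [-> |]; [unfold orient in *; lra |].
    assert (0 < orient (p i) (p (i + a)%nat) (p (i + h)%nat)) by (apply Ho; lia). lra.
Qed.

Lemma altitude_right h c p q : altitudes h c p q ->
  forall i a, (h < a < 2 * h + 1)%nat -> 0 < orient (p i) (q i) (p (i + a)%nat).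
Proof.
  intros A i a Ha.
  pose proof (alt_orient _ _ _ _ A i) as Ho. pose proof (alt_h _ _ _ _ A).
  assert (E : forall u, orient (p (i + a)%nat) (p i) u = orient (p i) u (p (i + a)%nat))
    by (intro; apply orient_rot).
  assert (0 < orient (p (i + a)%nat) (p i) (p (i + h)%nat))
    by (rewrite E; apply Ho; lia).
  assert (0 <= orient (p (i + a)%nat) (p i) (p (i + (h + 1))%nat)).
  { rewrite E. destruct (Nat.eq_dec a (h + 1)) as [-> |].
    - unfold orient; lra.
    - left; apply Ho; lia. }
  rewrite <- E.
  apply orient_in_segment with (1 := alt_segment _ _ _ _ A i); lra.
Qed.

(* Hyperbolic cosine of the distance from the foot [q i] to the end of its side. *)
Definition foot_cosh (h : nat) (p q : nat -> pt) (i : nat) : R :=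
  - lor (lift (q i)) (lift (p (i + (h + 1))%nat)).

(** A chord is the hypotenuse of two right triangles, each with an altitude as a leg; as the
    altitudes are equal, so are the other legs. *)
Lemma foot_cosh_sym h c p q : altitudes h c p q -> forall i,
  lor (lift (q (i + (h + 1))%nat)) (lift (p i)) = - foot_cosh h p q i.
Proof.
  intros A i. pose proof (alt_c _ _ _ _ A) as Hc.
  pose proof (alt_orth_l _ _ _ _ A (i + (h + 1))%nat) as E.
  replace (i + (h + 1) + h)%nat with (i + (2 * h + 1))%nat in E by lia.
  rewrite (alt_p _ _ _ _ A i), lor_sym, (alt_orth_r _ _ _ _ A) in E.
  apply Rmult_eq_reg_l with c; [| lra]. unfold foot_cosh. lra.
Qed.

(** Sign hypotheses of [chord_symmetry] and [altitudes_cross]: both feet lie on the same side of the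
    chord, and the altitude of [j] separates [q i] from [p i]. *)
Lemma chord_dets h c p q : altitudes h c p q -> forall i,
  let j := (i + (h + 1))%nat in
  det (lift (p i)) (lift (p j)) (lift (q i)) < 0 /\
  det (lift (p i)) (lift (p j)) (lift (q j)) < 0 /\
  det (lift (q j)) (lift (p j)) (lift (q i)) < 0.
Proof.
  intros A i j.
  pose proof (alt_h _ _ _ _ A). pose proof (alt_p _ _ _ _ A) as Hp.
  pose proof (alt_p_disk _ _ _ _ A). pose proof (alt_q_disk _ _ _ _ A).
  assert (Ei : p (j + h)%nat = p i).
  { replace (j + h)%nat with (i + (2 * h + 1))%nat by (unfold j; lia). apply Hp. }
  assert (Ej : p (j + 2 * h)%nat = p (i + h)%nat).
  { replace (j + 2 * h)%nat with (i + h + (2 * h + 1))%nat by (unfold j; lia). apply Hp. }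
  repeat split; apply det_lift_neg; auto.
  - pose proof (altitude_right h c p q A i (h + 1)%nat ltac:(lia)) as R. fold j in R.
    unfold orient in *; lra.
  - pose proof (altitude_left h c p q A j h ltac:(lia)) as R. rewrite Ei in R.
    unfold orient in *; lra.
  - enough (0 < orient (p j) (q j) (q i)) by (unfold orient in *; lra).
    pose proof (altitude_right h c p q A j (2 * h)%nat ltac:(lia)) as R. rewrite Ej in R.
    assert (Z : orient (p j) (q j) (p j) = 0) by (unfold orient; ring).
    eapply orient_in_segment; [exact (alt_segment _ _ _ _ A i) | | |]; fold j; lra.
Qed.

(** The right triangle on the chord has squared determinant [(c * c - 1) * (C * C - 1)], nonzero by
    [chord_dets]. *)
Lemma foot_cosh_gt1 h c p q : altitudes h c p q -> forall i, 1 < foot_cosh h p q i.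
Proof.
  intros A i. pose proof (alt_c _ _ _ _ A) as Hc.
  destruct (chord_dets h c p q A i) as (D1 & _ & _).
  pose proof (det_sqr (lift (p i)) (lift (p (i + (h + 1))%nat)) (lift (q i))) as E.
  rewrite !lor_lift_self, (alt_orth_r _ _ _ _ A), (alt_length _ _ _ _ A),
    (lor_sym (lift (p (i + (h + 1))%nat)) (lift (q i))) in E
    by (apply A).
  pose proof (lor_lift_le (q i) (p (i + (h + 1))%nat) (alt_q_disk _ _ _ _ A _)
    (alt_p_disk _ _ _ _ A _)) as L.
  fold (foot_cosh h p q i) in L.
  replace (lor (lift (q i)) (lift (p (i + (h + 1))%nat))) with (- foot_cosh h p q i) in E
    by (unfold foot_cosh; ring).
  set (d := det _ _ _) in *. set (C := foot_cosh h p q i) in *.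
  assert (d * d = (c * c - 1) * (C * C - 1)) as Ed by (rewrite E; ring).
  destruct L as [L | L]; [exact L |]. rewrite <- L in Ed. nra.
Qed.

(** * The star system of the altitudes *)

(* [tanh (x / 2)] as a function of [C = cosh x]. *)
Definition tanh_half (C : R) : R := (C - 1) / sqrt (C * C - 1).

Lemma tanh_half_pos C : 1 < C -> 0 < tanh_half C.
Proof.
  intro H. apply Rdiv_lt_0_compat; [lra | apply sqrt_lt_R0; nra].
Qed.

(** The square of [tanh_half C] is [(C - 1) / (C + 1)], which increases with [C]. *)
Lemma tanh_half_le C C' : 1 < C -> C <= C' -> tanh_half C <= tanh_half C'.
Proof.
  intros H H'. unfold tanh_half.
  assert (P : 0 < sqrt (C * C - 1)) by (apply sqrt_lt_R0; nra).
  assert (P' : 0 < sqrt (C' * C' - 1)) by (apply sqrt_lt_R0; nra).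
  assert (E : sqrt (C * C - 1) * sqrt (C * C - 1) = C * C - 1) by (apply sqrt_sqrt; nra).
  assert (E' : sqrt (C' * C' - 1) * sqrt (C' * C' - 1) = C' * C' - 1)
    by (apply sqrt_sqrt; nra).
  set (S := sqrt (C * C - 1)) in *. set (S' := sqrt (C' * C' - 1)) in *.
  apply Rmult_le_reg_r with (S * S'); [apply Rmult_lt_0_compat; lra |].
  replace ((C - 1) / S * (S * S')) with ((C - 1) * S') by (field; lra).
  replace ((C' - 1) / S' * (S * S')) with ((C' - 1) * S) by (field; lra).
  apply Rsqr_incr_0_var; [| apply Rmult_le_pos; lra]. unfold Rsqr.
  replace ((C - 1) * S' * ((C - 1) * S')) with ((C - 1) * (C - 1) * (S' * S')) by ring.
  replace ((C' - 1) * S * ((C' - 1) * S)) with ((C' - 1) * (C' - 1) * (S * S)) by ring.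
  rewrite E, E'.
  replace ((C - 1) * (C - 1) * (C' * C' - 1)) with
    ((C - 1) * (C' - 1) * ((C - 1) * (C' + 1))) by ring.
  replace ((C' - 1) * (C' - 1) * (C * C - 1)) with
    ((C - 1) * (C' - 1) * ((C' - 1) * (C + 1))) by ring.
  apply Rmult_le_compat_l; [apply Rmult_le_pos; lra | lra].
Qed.

(** Jumps of [h + 1], half of [n + 1] for [n = 2 * h + 1]: two of them advance by one vertex modulo
    [n]. *)
Definition star_index (h j k : nat) : nat := (j + k * (h + 1))%nat.

Definition star_normal (s : R) (h j : nat) (p q : nat -> pt) (k : nat) : vec :=
  comb ((-1) ^ k)
       (normal_of s (lift (q (star_index h j k))) (lift (p (star_index h j k))))
       0 (Vec 0 0 0).

Lemma lor_star_normal s h j p q k f : lor (star_normal s h j p q k) f =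
  (-1) ^ k *
  lor (normal_of s (lift (q (star_index h j k))) (lift (p (star_index h j k)))) f.
Proof. unfold star_normal. rewrite lor_comb_l. ring. Qed.

(** Consecutive terms satisfy [chord_symmetry]; the factor [(-1) ^ k] turns its sums of normals into
    differences. *)
Lemma star_system_altitudes h c s t j p q :
  altitudes h c p q -> 0 < s -> c * c = 1 + s * s ->
  (forall i, tanh_half (foot_cosh h p q i) <= t) ->
  star_system (2 * h + 1) c s t
    (fun k => lift (p (star_index h j k))) (fun k => lift (q (star_index h j k)))
    (star_normal s h j p q)
    (fun k => tanh_half (foot_cosh h p q (star_index h j k)))
    (fun k => let C := foot_cosh h p q (star_index h j k) in
              sqrt (C * C - 1) / (c * C - 1)).
Proof.
  intros A Hs Hcs Ht.
  pose proof (alt_c _ _ _ _ A) as Hc.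
  pose proof (alt_p_disk _ _ _ _ A) as Pd. pose proof (alt_q_disk _ _ _ _ A) as Qd.
  pose proof (alt_length _ _ _ _ A) as Hlen. pose proof (foot_cosh_sym h c p q A) as Hfw'.
  assert (Sn : forall k, star_index h j (S k) = (star_index h j k + (h + 1))%nat)
    by (intro k; unfold star_index; lia).
  assert (Per : forall X (u : nat -> X), periodic (2 * h + 1) u ->
    forall k, u (star_index h j (k + (2 * h + 1))) = u (star_index h j k)).
  { intros X u Hu k. rewrite <- (periodic_mult _ u Hu (star_index h j k) (h + 1)%nat).
    f_equal. unfold star_index. lia. }
  assert (Sq : forall i, let C := foot_cosh h p q i in
    0 < sqrt (C * C - 1) /\ sqrt (C * C - 1) * sqrt (C * C - 1) = C * C - 1 /\
    1 < c * C).
  { intros i C. pose proof (foot_cosh_gt1 h c p q A i) as H. fold C in H.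
    repeat split; [apply sqrt_lt_R0; nra | apply sqrt_sqrt; nra | nra]. }
  assert (Hij : forall i, lor (lift (p i)) (lift (p (i + (h + 1))%nat)) =
    - (c * foot_cosh h p q i))
    by (intro i; rewrite (alt_orth_r _ _ _ _ A); unfold foot_cosh; ring).
  assert (Hfw : forall i, lor (lift (q i)) (lift (p (i + (h + 1))%nat)) =
    - foot_cosh h p q i) by (intro i; unfold foot_cosh; ring).
  assert (Sym : forall k f, let i := star_index h j k in let C := foot_cosh h p q i in
    let gi := normal_of s (lift (q i)) (lift (p i)) in
    let gj := normal_of s (lift (q (i + (h + 1))%nat)) (lift (p (i + (h + 1))%nat)) in
    lor gi f + lor gj f = sqrt (C * C - 1) / (c * C - 1) *
      (lor (lift (p i)) f - lor (lift (p (i + (h + 1))%nat)) f) /\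
    (lor (lift (p i)) f + lor (lift (q i)) f)
      - (lor (lift (p (i + (h + 1))%nat)) f + lor (lift (q (i + (h + 1))%nat)) f) =
      (c + 1) * tanh_half C * (lor gi f + lor gj f) /\
    -1 <= lor gi gj <= 1).
  { intros k f i C gi gj. destruct (Sq i) as (S1 & S2 & S3). fold C in S1, S2, S3.
    destruct (chord_dets h c p q A i) as (D1 & D2 & D3).
    assert (HC : 0 < C) by (pose proof (foot_cosh_gt1 h c p q A i); unfold C; lra).
    destruct (chord_symmetry c s C (sqrt (C * C - 1)) (lift (p i))
      (lift (p (i + (h + 1))%nat)) (lift (q i)) (lift (q (i + (h + 1))%nat)))
      as (R1 & R2 & _); auto using lor_lift_self.
    split; [apply R1 | split; [apply R2 |]].
    apply (altitudes_cross c s C (sqrt (C * C - 1)));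
      auto using lor_lift_self.
    rewrite lor_normal_of. apply Rmult_lt_reg_r with s; [lra |].
    unfold Rdiv; rewrite Rmult_assoc, Rinv_l; lra. }
  assert (Hrange : forall i a, (0 < a < 2 * h + 1)%nat ->
    0 < (if le_lt_dec a h then 1 else -1) * det (lift (q i)) (lift (p i)) (lift (p (i + a)%nat))).
  { intros i a Ha. destruct (le_lt_dec a h).
    - rewrite Rmult_1_l. apply det_lift_pos; auto. apply (altitude_left h c p q A); lia.
    - enough (det (lift (q i)) (lift (p i)) (lift (p (i + a)%nat)) < 0) by lra.
      apply det_lift_neg; auto.
      pose proof (altitude_right h c p q A i a ltac:(lia)). unfold orient in *; lra. }
  constructor; try assumption.
  - intro k. f_equal. apply Per, A.
  - intro k. f_equal. apply Per, A.
  - rewrite pow_add, pow_mult. replace ((-1) ^ 2) with 1 by ring. rewrite pow1. ring.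
  - auto using lor_lift_self.
  - auto using lor_lift_self.
  - intro k. apply (alt_length _ _ _ _ A).
  - intros k l. pose proof (lor_lift_le _ _ (Pd (star_index h j k)) (Pd (star_index h j l))).
    lra.
  - intros k f. rewrite lor_star_normal, lor_normal_of. unfold Rdiv; ring.
  - intros k f. destruct (Sym k f) as (R & _ & _). rewrite !lor_star_normal, Sn.
    cbv zeta. rewrite Rmult_assoc, <- R. cbn [pow]. ring.
  - intros k f. destruct (Sym k f) as (_ & R & _). rewrite !lor_star_normal, Sn, R.
    cbn [pow].
    set (u := lor (normal_of _ _ _) f). set (w := lor (normal_of _ (lift (q (_ + _)%nat)) _) f).
    set (T := tanh_half _). pose proof (pow_m1_sqr k) as E.
    transitivity ((c + 1) * T * ((-1) ^ k * (-1) ^ k) * (u + w)); [rewrite E; ring | ring].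
  - intros m k Hk. rewrite lor_star_normal, lor_normal_of.
    (* Modulo the period, [2 * r] jumps amount to [r] vertices and [2 * r + 1] jumps to [h + 1 + r];
       so the parity decides the side of the altitude. *)
    destruct (Nat.Even_or_Odd (k - m)) as [[r Hr] | [r Hr]].
    + assert (E : p (star_index h j k) = p (star_index h j m + r)%nat).
      { rewrite <- (periodic_mult _ p (alt_p _ _ _ _ A) (star_index h j m + r)%nat r). f_equal.
        unfold star_index. nia. }
      rewrite E. pose proof (Hrange (star_index h j m) r ltac:(lia)) as P.
      destruct (le_lt_dec r h); [| lia].
      replace k with (m + 2 * r)%nat by lia.
      rewrite pow_add, pow_mult. replace ((-1) ^ 2) with 1 by ring. rewrite pow1.
      rewrite Rmult_1_r, <- Rmult_assoc, pow_m1_sqr, Rmult_1_l.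
      apply Rdiv_lt_0_compat; lra.
    + assert (E : p (star_index h j k) = p (star_index h j m + (h + 1 + r))%nat).
      { rewrite <- (periodic_mult _ p (alt_p _ _ _ _ A)
          (star_index h j m + (h + 1 + r))%nat r). f_equal.
        unfold star_index. nia. }
      rewrite E. pose proof (Hrange (star_index h j m) (h + 1 + r)%nat ltac:(lia)) as P.
      destruct (le_lt_dec (h + 1 + r) h); [lia |].
      replace k with (m + (2 * r + 1))%nat by lia.
      rewrite !pow_add, pow_mult. replace ((-1) ^ 2) with 1 by ring. rewrite pow1.
      set (d := det _ _ _) in *.
      replace ((-1) ^ m * (1 * (-1) ^ 1) * ((-1) ^ m * (d / s))) with
        (((-1) ^ m * (-1) ^ m) * (- d / s)) by (field; lra).
      rewrite pow_m1_sqr, Rmult_1_l. apply Rdiv_lt_0_compat; lra.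
  - intro k. destruct (Sym k (Vec 0 0 0)) as (_ & _ & R).
    rewrite lor_star_normal, lor_sym, lor_star_normal, lor_sym, Sn.
    set (d := lor _ _) in *. cbn [pow].
    replace ((-1) ^ k * (-1 * (-1) ^ k * d)) with (- (((-1) ^ k * (-1) ^ k) * d)) by ring.
    rewrite pow_m1_sqr. lra.
  - intro k. destruct (Sq (star_index h j k)) as (S1 & S2 & S3).
    apply Rdiv_lt_0_compat; lra.
  - intro k. split; [| apply Ht].
    left. apply tanh_half_pos, (foot_cosh_gt1 h c p q A).
Qed.

(** * Distances between vertices *)

Lemma finite_max (f : nat -> R) n : (0 < n)%nat ->
  exists i, (i < n)%nat /\ forall j, (j < n)%nat -> f j <= f i.
Proof.
  induction n as [| n IH]; [lia |]. intros _.
  destruct n as [| n].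
  - exists 0%nat. split; [lia |]. intros j Hj. replace j with 0%nat by lia. lra.
  - destruct IH as (i & Hi & Hmax); [lia |].
    destruct (Rle_dec (f i) (f (S n))) as [H | H].
    + exists (S n). split; [lia |]. intros j Hj.
      destruct (Nat.eq_dec j (S n)) as [-> |]; [lra |].
      specialize (Hmax j ltac:(lia)). lra.
    + exists i. split; [lia |]. intros j Hj.
      destruct (Nat.eq_dec j (S n)) as [-> |]; [lra |]. apply Hmax; lia.
Qed.

(** The star starts at the largest value [Cj], where [longest_chord_bound] gives
    [2 Cj - 1/Cj <= c = 2 C - 1/C]; the function is increasing. *)
Lemma foot_cosh_bound h c p q C : altitudes h c p q ->
  1 < C -> c * C = 2 * (C * C) - 1 -> forall i, foot_cosh h p q i <= C.
Proof.
  intros A HC HcC.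
  pose proof (alt_c _ _ _ _ A) as Hc. pose proof (alt_h _ _ _ _ A) as Hh.
  destruct (finite_max (foot_cosh h p q) (2 * h + 1)) as (j & _ & Hmax); [lia |].
  assert (Hall : forall i, foot_cosh h p q i <= foot_cosh h p q j).
  { assert (Per : periodic (2 * h + 1) (foot_cosh h p q)).
    { intro i. unfold foot_cosh. rewrite (alt_q _ _ _ _ A).
      replace (i + (2 * h + 1) + (h + 1))%nat with (i + (h + 1) + (2 * h + 1))%nat by lia.
      rewrite (alt_p _ _ _ _ A). reflexivity. }
    intro i. set (n := (2 * h + 1)%nat) in *.
    pose proof (Nat.div_mod_eq i n) as E.
    replace i with (i mod n + i / n * n)%nat by lia.
    rewrite (periodic_mult n _ Per). apply Hmax, Nat.mod_upper_bound. unfold n; lia. }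
  set (Cj := foot_cosh h p q j) in *.
  pose proof (foot_cosh_gt1 h c p q A j) as Hj. fold Cj in Hj.
  assert (Hs : 0 < sqrt (c * c - 1)) by (apply sqrt_lt_R0; nra).
  assert (HS : 0 < sqrt (Cj * Cj - 1)) by (apply sqrt_lt_R0; nra).
  pose proof (star_system_altitudes h c (sqrt (c * c - 1)) (tanh_half Cj) j p q A Hs)
    as HH.
  specialize (HH ltac:(rewrite sqrt_sqrt; nra)).
  specialize (HH (fun i => tanh_half_le _ _ (foot_cosh_gt1 h c p q A i) (Hall i))).
  assert (E0 : star_index h j 0 = j) by (unfold star_index; lia).
  assert (E1 : star_index h j 1 = (j + (h + 1))%nat) by (unfold star_index; lia).
  assert (B : 2 * (Cj * Cj) - 1 <= c * Cj).
  { apply (longest_chord_bound _ _ _ _ _ _ _ _ _ Cj (sqrt (Cj * Cj - 1)) HH);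
      rewrite ?E0, ?E1; try lia; try lra.
    - apply sqrt_sqrt; nra.
    - rewrite (alt_orth_r _ _ _ _ A). unfold Cj, foot_cosh. ring.
    - apply (foot_cosh_sym h c p q A).
    - unfold Cj, foot_cosh. ring.
    - reflexivity.
    - reflexivity.
    - apply tanh_half_pos; exact Hj. }
  assert (Cj <= C).
  { apply Rnot_lt_le; intro.
    (* The product equals [C * (2 * (Cj * Cj) - 1) - Cj * (2 * (C * C) - 1)]. *)
    assert (0 < (Cj - C) * (2 * C * Cj + 1)) by (apply Rmult_lt_0_compat; nra).
    assert (c * C * Cj = (2 * (C * C) - 1) * Cj) by (rewrite HcC; ring).
    assert (C * (2 * (Cj * Cj) - 1) <= C * (c * Cj)) by (apply Rmult_le_compat_l; lra).
    lra. }
  intro i. specialize (Hall i). lra.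
Qed.

Lemma odd_step_bound h c p q C j r : altitudes h c p q ->
  1 < C -> c * C = 2 * (C * C) - 1 -> Nat.Odd r -> (r < 2 * h + 1)%nat ->
  let k := star_index h j r in
  lor (lift (p j)) (lift (p k)) <= lor (lift (q k)) (lift (p j)) ->
  lor (lift (p j)) (lift (p k)) <= lor (lift (q j)) (lift (p k)) ->
  - lor (lift (p j)) (lift (p k)) <= 2 * (C * C) - 1.
Proof.
  intros A HC HcC [m Hm] Hr k H1 H2.
  pose proof (alt_c _ _ _ _ A) as Hc.
  assert (Hs : 0 < sqrt (c * c - 1)) by (apply sqrt_lt_R0; nra).
  assert (HS : 0 < sqrt (C * C - 1)) by (apply sqrt_lt_R0; nra).
  assert (E0 : star_index h j 0 = j) by (unfold star_index; lia).
  pose proof (star_system_altitudes h c (sqrt (c * c - 1)) (tanh_half C) j p q A Hs)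
    as HH.
  specialize (HH ltac:(rewrite sqrt_sqrt; nra)).
  specialize (HH (fun i => tanh_half_le _ _ (foot_cosh_gt1 h c p q A i)
                   (foot_cosh_bound h c p q C A HC HcC i))).
  pose proof (diagonal_bound _ _ _ _ _ _ _ _ r C (sqrt (C * C - 1)) HC HS
    ltac:(apply sqrt_sqrt; nra) HcC HH Hr) as B.
  cbv beta in B. rewrite E0 in B. apply B; [| exact H1 | exact H2].
  rewrite Hm, pow_add, pow_mult. replace ((-1) ^ 2) with 1 by ring. rewrite pow1. ring.
Qed.

(** Advancing by [d] vertices takes [2 * d] jumps; this differs from the odd period by an odd number
    of jumps, leading from [k] to [i] or from [i] to [k]. *)
Lemma vertex_distance_bound h c p q C i k : altitudes h c p q ->
  1 < C -> c * C = 2 * (C * C) - 1 -> (i < k < 2 * h + 1)%nat ->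
  lor (lift (p i)) (lift (p k)) <= lor (lift (q k)) (lift (p i)) ->
  lor (lift (p i)) (lift (p k)) <= lor (lift (q i)) (lift (p k)) ->
  - lor (lift (p i)) (lift (p k)) <= 2 * (C * C) - 1.
Proof.
  intros A HC HcC Hik H1 H2.
  pose proof (alt_p _ _ _ _ A) as Pp. pose proof (alt_q _ _ _ _ A) as Pq.
  set (d := (k - i)%nat).
  destruct (le_lt_dec (2 * d) (2 * h)) as [Hd | Hd].
  - set (r := (2 * h + 1 - 2 * d)%nat).
    assert (E : star_index h k r = (i + (h + 1 - d) * (2 * h + 1))%nat).
    { unfold star_index, r, d in *. nia. }
    assert (Ep : p (star_index h k r) = p i) by (rewrite E; apply periodic_mult, Pp).
    assert (Eq : q (star_index h k r) = q i) by (rewrite E; apply periodic_mult, Pq).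
    rewrite lor_sym in H1, H2 |- *.
    pose proof (odd_step_bound h c p q C k r A HC HcC) as B.
    cbv zeta in B. rewrite Ep, Eq in B.
    apply B; [exists (h - d)%nat; unfold r, d in *; lia | unfold r, d in *; lia | |].
    + exact H2.
    + exact H1.
  - set (r := (2 * d - (2 * h + 1))%nat).
    assert (E : star_index h i r = (k + (d - h - 1) * (2 * h + 1))%nat).
    { unfold star_index, r, d in *. nia. }
    assert (Ep : p (star_index h i r) = p k) by (rewrite E; apply periodic_mult, Pp).
    assert (Eq : q (star_index h i r) = q k) by (rewrite E; apply periodic_mult, Pq).
    pose proof (odd_step_bound h c p q C i r A HC HcC) as B.
    cbv zeta in B. rewrite Ep, Eq in B.
    apply B; [exists (d - h - 1)%nat; unfold r, d in *; lia | unfold r, d in *; lia | |];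
      assumption.
Qed.

(** * Convex hulls *)

Lemma sumR_ext n f g : (forall i, (i < n)%nat -> f i = g i) -> sumR n f = sumR n g.
Proof. induction n; simpl; intro H; [reflexivity | rewrite IHn, H; auto]. Qed.

Lemma sumR_plus n f g : sumR n (fun i => f i + g i) = sumR n f + sumR n g.
Proof. induction n; simpl; [ring | rewrite IHn; ring]. Qed.

Lemma sumR_scal n a f : sumR n (fun i => a * f i) = a * sumR n f.
Proof. induction n; simpl; [ring | rewrite IHn; ring]. Qed.

Lemma sumR_le n f g : (forall i, (i < n)%nat -> f i <= g i) -> sumR n f <= sumR n g.
Proof.
  induction n; simpl; intro H; [lra |].
  apply Rplus_le_compat; [apply IHn; auto | apply H; lia].
Qed.

Lemma sumR_single n a r g : (a < n)%nat ->
  sumR n (fun i => (if Nat.eq_dec i a then r else 0) * g i) = r * g a.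
Proof.
  assert (Z : forall m, (m <= a)%nat ->
    sumR m (fun i => (if Nat.eq_dec i a then r else 0) * g i) = 0).
  { induction m; simpl; intro Hm; [reflexivity |].
    rewrite IHm by lia. destruct (Nat.eq_dec m a); [lia | ring]. }
  induction n; simpl; intro Ha; [lia |].
  destruct (Nat.eq_dec n a) as [E | E].
  - rewrite Z by lia. rewrite E. ring.
  - rewrite IHn by lia. ring.
Qed.

Lemma sumR_weighted_pos n w a :
  (forall i, (i < n)%nat -> 0 <= w i) -> (forall i, (i < n)%nat -> 0 < a i) ->
  0 < sumR n w -> 0 < sumR n (fun i => w i * a i).
Proof.
  induction n; simpl; intros Hw Ha Hs; [lra |].
  assert (0 <= sumR n (fun i => w i * a i)).
  { replace 0 with (sumR n (fun _ => 0 * 0)).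
    - apply sumR_le. intros i Hi. rewrite Rmult_0_l.
      apply Rmult_le_pos; [apply Hw; lia | apply Rlt_le, Ha; lia].
    - rewrite sumR_scal. ring. }
  pose proof (Hw n ltac:(lia)) as [H1 | H1]; pose proof (Ha n ltac:(lia)).
  - assert (0 < w n * a n) by (apply Rmult_lt_0_compat; assumption). lra.
  - rewrite <- H1 in *. rewrite Rmult_0_l, Rplus_0_r.
    apply IHn; auto; lra.
Qed.

(** Averaging [2 (1 - p.v) >= (1 - |p|^2) + (1 - |v|^2)] over the weights bounds [1 - |p|^2] below
    by the average of [1 - |v|^2]. *)
Lemma hull_in_disk n v p : (forall i, (i < n)%nat -> in_disk (v i)) -> hull n v p ->
  in_disk p.
Proof.
  intros Hv (w & Hw & Hs & E1 & E2).
  assert (E : 1 - sqnorm p = sumR n (fun i => w i * (1 - dot p (v i)))).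
  { transitivity (sumR n (fun i => w i + (- fst p) * (w i * fst (v i))
                                   + (- snd p) * (w i * snd (v i)))).
    - rewrite !sumR_plus, !sumR_scal, Hs, <- E1, <- E2. unfold sqnorm; ring.
    - apply sumR_ext; intros; unfold dot; ring. }
  assert (P : 0 < sumR n (fun i => w i * (1 - sqnorm (v i)))).
  { apply sumR_weighted_pos; [exact Hw | | lra].
    intros i Hi. specialize (Hv i Hi). unfold in_disk in Hv. unfold sqnorm; lra. }
  assert (Q : sumR n (fun i => (1 - sqnorm p) * w i + w i * (1 - sqnorm (v i)))
              <= sumR n (fun i => 2 * (w i * (1 - dot p (v i))))).
  { apply sumR_le. intros i Hi.
    enough (0 <= w i * (2 * (1 - dot p (v i)) - (1 - sqnorm p) - (1 - sqnorm (v i)))) by lra.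
    apply Rmult_le_pos; [auto |]. unfold dot, sqnorm.
    pose proof (Rle_0_sqr (fst p - fst (v i))). pose proof (Rle_0_sqr (snd p - snd (v i))).
    unfold Rsqr in *. lra. }
  rewrite sumR_plus, !sumR_scal, Hs, <- E in Q.
  unfold in_disk. unfold sqnorm in *. lra.
Qed.

(* Balls of the hyperbolic plane are convex. *)
Lemma hull_lor_le n v p x z : (forall i, (i < n)%nat -> in_disk (v i)) -> hull n v p ->
  0 <= z -> (forall i, (i < n)%nat -> - lor x (lift (v i)) <= z) ->
  - lor x (lift p) <= z.
Proof.
  intros Hv Hp Hz Hx. pose proof (hull_in_disk n v p Hv Hp) as Hd.
  destruct Hp as (w & Hw & Hs & E1 & E2).
  pose proof (scale_pos p Hd) as Sp.
  (* [scale p * lift p] is affine in [p], hence the weighted sum of the same vectors at the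
     vertices. *)
  assert (Lin : forall y, scale p * (- lor y (lift p)) =
    sumR n (fun i => w i * scale (v i) * (- lor y (lift (v i))))).
  { intro y.
    transitivity (sumR n (fun i => (- vx y) * (w i * fst (v i))
                            + (- vy y) * (w i * snd (v i)) + vt y * w i)).
    - rewrite !sumR_plus, !sumR_scal, Hs, <- E1, <- E2.
      unfold lor, lift; simpl. field; lra.
    - apply sumR_ext. intros i Hi. pose proof (scale_pos _ (Hv i Hi)).
      unfold lor, lift; simpl. field; lra. }
  (* The case [y = lift p], where every product is at least 1. *)
  assert (Hsc : sumR n (fun i => w i * scale (v i)) <= scale p).
  { rewrite <- (Rmult_1_r (scale p)).
    replace 1 with (- lor (lift p) (lift p)) by (rewrite lor_lift_self; [ring | exact Hd]).
    rewrite Lin. apply sumR_le. intros i Hi.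
    rewrite <- (Rmult_1_r (w i * scale (v i))) at 1.
    apply Rmult_le_compat_l; [| apply lor_lift_le; auto].
    apply Rmult_le_pos; [auto | apply Rlt_le, scale_pos; auto]. }
  apply Rmult_le_reg_l with (scale p); [exact Sp |]. rewrite Lin.
  apply Rle_trans with (sumR n (fun i => z * (w i * scale (v i)))).
  - apply sumR_le. intros i Hi. rewrite (Rmult_comm z).
    apply Rmult_le_compat_l; [| auto].
    apply Rmult_le_pos; [auto | apply Rlt_le, scale_pos; auto].
  - rewrite sumR_scal, (Rmult_comm z). apply Rmult_le_compat_r; assumption.
Qed.

Lemma in_segment_hull n v a b f : (a < n)%nat -> (b < n)%nat ->
  in_segment (v a) (v b) f -> hull n v f.
Proof.
  intros Ha Hb (t & Ht & F1 & F2).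
  exists (fun i => (if Nat.eq_dec i a then 1 - t else 0)
                   + (if Nat.eq_dec i b then t else 0)).
  assert (Sum : forall g, sumR n (fun i => ((if Nat.eq_dec i a then 1 - t else 0)
                   + (if Nat.eq_dec i b then t else 0)) * g i)
                = (1 - t) * g a + t * g b).
  { intro g. rewrite <- (sumR_single n a (1 - t) g Ha), <- (sumR_single n b t g Hb),
      <- sumR_plus. apply sumR_ext; intros; ring. }
  split; [| split; [| split]].
  - intros i _. destruct (Nat.eq_dec i a), (Nat.eq_dec i b); lra.
  - transitivity ((1 - t) * 1 + t * 1); [| ring].
    rewrite <- (Sum (fun _ => 1)). apply sumR_ext; intros; ring.
  - rewrite Sum, F1. ring.
  - rewrite Sum, F2. ring.
Qed.

(** By convexity of balls the largest distance occurs between two vertices. The feet belong to the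
    hull, so this pair meets the distance hypotheses of [vertex_distance_bound]. *)
Lemma hull_distance_bound h c n v q C : (n = 2 * h + 1)%nat ->
  altitudes h c (fun i => v (i mod n)%nat) q ->
  (forall i, exists a b, (a < n)%nat /\ (b < n)%nat /\ in_segment (v a) (v b) (q i)) ->
  (forall i, (i < n)%nat -> in_disk (v i)) ->
  1 < C -> c * C = 2 * (C * C) - 1 ->
  forall x y, hull n v x -> hull n v y -> - lor (lift x) (lift y) <= 2 * (C * C) - 1.
Proof.
  intros Hn A Hq Hv HC HcC x y Hx Hy.
  set (d := fun i k => - lor (lift (v i)) (lift (v k))).
  assert (Hpair : exists i k, (i < n)%nat /\ (k < n)%nat /\
    forall i' k', (i' < n)%nat -> (k' < n)%nat -> d i' k' <= d i k).
  { destruct (finite_max (fun m => d (m / n)%nat (m mod n)%nat) (n * n)) as (m & Hm & Hmax);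
      [nia |].
    exists (m / n)%nat, (m mod n)%nat. split; [apply Nat.Div0.div_lt_upper_bound; lia |].
    split; [apply Nat.mod_upper_bound; lia |]. intros i' k' Hi Hk.
    specialize (Hmax (k' + i' * n)%nat ltac:(nia)). cbv beta in Hmax.
    rewrite Nat.div_add, Nat.div_small, Nat.Div0.mod_add, Nat.mod_small in Hmax by lia.
    exact Hmax. }
  destruct Hpair as (i & k & Hi & Hk & Hmax).
  assert (H1 : 1 <= d i k) by (apply lor_lift_le; auto).
  assert (Hvert : forall z m, hull n v z -> (m < n)%nat ->
    - lor (lift (v m)) (lift z) <= d i k).
  { intros z m Hz Hm. apply (hull_lor_le n v); auto; [lra |].
    intros l Hl. apply Hmax; assumption. }
  apply Rle_trans with (d i k).
  - apply (hull_lor_le n v); auto; [lra |].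
    intros l Hl. rewrite lor_sym. apply Hvert; assumption.
  - assert (Foot : forall m l, (m < n)%nat -> - lor (lift (v m)) (lift (q l)) <= d i k).
    { intros m l Hm. apply Hvert; [| exact Hm].
      destruct (Hq l) as (a & b & Ha & Hb & Hab). exact (in_segment_hull n v a b _ Ha Hb Hab). }
    assert (Main : forall i k, (i < k < n)%nat ->
      (forall m l, (m < n)%nat -> - lor (lift (v m)) (lift (q l)) <= d i k) ->
      d i k <= 2 * (C * C) - 1).
    { intros a b Hab HF.
      pose proof (vertex_distance_bound h c _ q C a b A HC HcC ltac:(lia)) as B.
      cbv beta in B. rewrite !Nat.mod_small in B by lia. apply B.
      - pose proof (HF a b ltac:(lia)) as F. rewrite lor_sym in F. unfold d in F. lra.
      - pose proof (HF b a ltac:(lia)) as F. rewrite lor_sym in F. unfold d in F. lra. }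
    destruct (lt_eq_lt_dec i k) as [[Hlt | Heq] | Hgt].
    + apply Main; auto.
    + unfold d. rewrite Heq, lor_lift_self by auto. nra.
    + assert (E : d i k = d k i) by (unfold d; rewrite lor_sym; reflexivity).
      rewrite E in *. apply Main; auto.
Qed.

(** * The bound on the diameter *)

Lemma cosh_sinh_sqr x : cosh x * cosh x - sinh x * sinh x = 1.
Proof.
  unfold cosh, sinh.
  transitivity (exp x * exp (- x)); [field |].
  rewrite <- exp_plus, Rplus_opp_r. apply exp_0.
Qed.

Theorem theorem3 (n : nat) (v : nat -> pt) (Delta D : R) :
  ordinary_reduced n v ->
  is_thickness (hull n v) Delta ->
  is_diam (hull n v) D ->
  D < arcosh (cosh Delta * sqrt (1 + / 3 * (sinh Delta) ^ 2)).
Proof.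
  intros Hr Ht ((x & y & Hx & Hy & <-) & _).
  destruct (ordinary_reduced_altitudes n v Delta Hr Ht) as (h & q & Hn & A & Hq).
  destruct Hr as (_ & (_ & Hdisk & _) & _).
  pose proof (alt_c _ _ _ _ A) as Hc.
  set (c := cosh Delta) in *.
  (* [C] below is the positive root of [2 * C ^ 2 - c * C - 1 = 0], of discriminant [c * c + 8];
     then [2 * (C * C) - 1] is the hyperbolic cosine of the side of the regular triangle of
     thickness [Delta]. *)
  set (s := sqrt (c * c + 8)).
  assert (Hss : s * s = c * c + 8) by (apply sqrt_sqrt; nra).
  assert (Hs : 0 < s) by (apply sqrt_lt_R0; nra).
  set (C := (c + s) / 4).
  assert (HcC : c * C = 2 * (C * C) - 1) by (unfold C; nra).
  assert (HC : 1 < C) by (unfold C; assert (3 < s) by (apply Rnot_le_lt; intro; nra); lra).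
  pose proof (hull_in_disk n v x Hdisk Hx) as Dx.
  pose proof (hull_in_disk n v y Hdisk Hy) as Dy.
  rewrite hdist_lift by assumption.
  apply arcosh_lt; [apply lor_lift_le; assumption |].
  apply Rle_lt_trans with (2 * (C * C) - 1).
  { apply (hull_distance_bound h c n v q); assumption. }
  rewrite <- HcC. apply Rmult_lt_compat_l; [lra |].
  assert (E : 1 + / 3 * sinh Delta ^ 2 = (c * c + 2) / 3).
  { pose proof (cosh_sinh_sqr Delta) as I. fold c in I. simpl. lra. }
  rewrite E, <- (sqrt_square C) by lra. apply sqrt_lt_1; [nra | nra |].
  (* [c = 2C - 1/C], so [c^2 + 2 - 3C^2 = (C - 1/C)^2] *)
  assert (H2 : (c * C) * (c * C) = (2 * (C * C) - 1) * (2 * (C * C) - 1))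
    by (rewrite HcC; reflexivity).
  assert (HC2 : 0 < C * C - 1) by (apply Rlt_0_minus; nra).
  pose proof (Rmult_lt_0_compat _ _ HC2 HC2).
  assert (0 < (C * C) * (c * c + 2 - 3 * (C * C))) by lra.
  assert (0 < c * c + 2 - 3 * (C * C)); [| lra].
  apply Rmult_lt_reg_l with (C * C); nra.
Qed.
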